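(* Let $k=8$. The IMEX-LMM8 scheme defined by $$\boldsymbol{A}^{(8)}=\left[\tfrac{4369}{840},-\tfrac{581}{30},\tfrac{181}{5},-\tfrac{1327}{30},\tfrac{115}{3},-\tfrac{241}{10},\tfrac{51}{5},-\tfrac{527}{210},\tfrac{11}{40}\right]^\top,\quad \boldsymbol{B}^{(8)}=[2,-2,0,2,-1,0,0,0,0]^\top,$$ $$\hat{\boldsymbol{B}}^{(8)}=[14,-56,114,-141,112,-56,16,-2]^\top$$ together with the multiplier coefficient vector $\boldsymbol{\mu}=\frac14[9,-13,10,0,-5,6,-4,1]^\top$ satisfies the feasibility conditions (FP) of the context with $\alpha=1/64$ and $\beta=1/53$. Hence the scheme admits modified energy dissipation: for the gradient flow in the setting of the context, $E_G^{n+1}\le E_G^n$ (for $k-1\le n\le N-1$) whenever $0<\tau\le\tau_{\max}$. The corresponding positive definite matrices $G_a,G_B$ in the modified energy $E_G^n$ satisfy the positive-definiteness conditions (PDC) of the context (with these $\alpha,\beta$) and are given by $$G_a=\frac1{10000}\begin{bmatrix}75508&-160956&203546&-159950&92595&-35176&5454\\-160956&368482&-475338&383138&-219714&84760&-13766\\203546&-475338&628068&-513809&296772&-113163&19825\\-159950&383138&-513809&431646&-251786&96567&-16157\\92595&-219714&296772&-251786&152167&-59983&11044\\-35176&84760&-113163&96567&-59983&26738&-5601\\5454&-13766&19825&-16157&11044&-5601&2960\end{bmatrix},$$ $$G_B=\frac1{100000}\begin{bmatrix}403371&-657208&461064&36464&-260305&251117&-163689&41686\\-657208&1197243&-931714&-666&496571&-474187&275524&-68063\\461064&-931714&897993&-194792&-349955&440110&-254248&56542\\36464&-666&-194792&304571&-153239&-51486&79210&-20062\\-260305&496571&-349955&-153239&404839&-290673&105937&-15675\\251117&-474187&440110&-51486&-290673&379082&-232868&53905\\-163689&275524&-254248&79210&105937&-232868&199388&-59254\\41686&-68063&56542&-20062&-15675&53905&-59254&23421\end{bmatrix}.$$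 In particular, the constant $\hat c_0$ appearing in $\tau_{\max}$ equals $25043/4$.
   Context: Abstract setting. $\Omega=(-\pi,\pi)^d$, $d\in\{1,2,3\}$, with periodic boundary conditions; $(v,w)=\int_\Omega vw\,\mathrm{d}\boldsymbol{x}$, $\|v\|=(v,v)^{1/2}$. $H$ is a Hilbert space with inner product $(\cdot,\cdot)$ and norm $\|\cdot\|$; $S,V$ are Hilbert spaces with $S\hookrightarrow V\hookrightarrow H$ (continuous and compact embeddings); $V'$ is the dual of $V$ and $V\subset H\subset V'$ is a Gelfand triple with duality pairing $\langle\cdot,\cdot\rangle_{V',V}$. $\mathcal{L}:S\to V$ is linear with $(\mathcal{L}u,v)=(u,\mathcal{L}v)$ and $(\mathcal{L}v,v)\ge 0$ for $u,v\in S$; $\|\mathcal{L}^{1/2}u\|:=(\mathcal{L}u,u)^{1/2}$. $\mathcal{M}:V\to V'$ is linear and self-adjoint, $\langle\mathcal{M}u,v\rangle_{V',V}=\langle\mathcal{M}v,u\rangle_{V',V}$, and there are constants $C_{\mathcal M},c_{\mathcal M}>0$ with $|\langle\mathcal{M}u,v\rangle_{V',V}|\le C_{\mathcal M}\|u\|_V\|v\|_V$ and $-\langle\mathcal{M}v,v\rangle_{V',V}\ge c_{\mathcal M}\|v\|_V^2$ for all $u,v\in V$; hence $\mathcal{M}^{-1}:V'\to V$ is bounded, self-adjoint and negative definite. For $v\in H$, $\|(-\mathcal{M})^{-1/2}v\|:=(v,-\mathcal{M}^{-1}v)^{1/2}$. There exist constants $\zeta>0$ and $0<\eta\le 1$ with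 $\|v\|\le\zeta\|(-\mathcal{M})^{-1/2}v\|^{\eta}\|\mathcal{L}^{1/2}v\|^{1-\eta}$ for all $v\in S$. Nonlinearity. $f(u)=F'(u)$ for a potential $F$, with $(F(u),1):=\int_\Omega F(u)\,\mathrm{d}\boldsymbol{x}\ge 0$. $f:S\to V$ is globally Lipschitz: $\|f(u)-f(v)\|\le\ell_f\|u-v\|$ for all $u,v\in S$ ($\ell_f>0$), and (as a consequence) $|(F(u)-F(v),1)-(f(v),u-v)|\le\frac{\ell_f}{2}\|u-v\|^2$ for all $u,v\in S$. Gradient flow: $u_t=\mathcal{M}[\mathcal{L}u+f(u)]$, $u(0)=u^0$, on $(0,T]$. Scheme. Let $\tau=T/N$, $t_n=n\tau$. Given $u^0,\ldots,u^{k-1}\in S$, the $k$-step IMEX-LMM with coefficient vectors $\boldsymbol{A}^{(k)}=[A_0^{(k)},\ldots,A_k^{(k)}]^\top$, $\boldsymbol{B}^{(k)}=[B_0^{(k)},\ldots,B_k^{(k)}]^\top$, $\hat{\boldsymbol{B}}^{(k)}=[\hat B_1^{(k)},\ldots,\hat B_k^{(k)}]^\top$ is, for $k-1\le n\le N-1$ (with solution $u^{n+1}\in S$), $$\sum_{i=0}^kA_i^{(k)}u^{n+1-i}=\tau\mathcal{M}\Big[\sum_{i=0}^kB_i^{(k)}\mathcal{L}u^{n+1-i}+\sum_{i=1}^k\hat B_i^{(k)}f(u^{n+1-i})\Big].$$ The coefficients satisfy the order conditions $\sum_{i=0}^kA_i^{(k)}=0$ and, for $0\le m\le k-1$, $\sum_{i=0}^kA_i^{(k)}(-i)^{m+1}=(m+1)\sum_{i=0}^kB_i^{(k)}(-i)^m=(m+1)\sum_{i=1}^k\hat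 B_i^{(k)}(-i)^m$, and the normalization $\sum_{i=0}^kA_i^{(k)}(-i)=\sum_{i=0}^kB_i^{(k)}=\sum_{i=1}^k\hat B_i^{(k)}=1$; given $\boldsymbol{B}^{(k)}$, the order conditions determine $\boldsymbol{A}^{(k)}$ and $\hat{\boldsymbol{B}}^{(k)}$ uniquely. Convention: $0^0=1$ throughout. Put $\delta u^j=u^j-u^{j-1}$, $a_i^{(k)}=\sum_{j=0}^iA_j^{(k)}$ ($0\le i\le k-1$), $\hat b_i^{(k)}=\sum_{j=1}^i\hat B_j^{(k)}-1$ ($1\le i\le k-1$), $\boldsymbol{a}^{(k)}=[a_0^{(k)},\ldots,a_{k-1}^{(k)}]^\top$. Multiplier. For $\boldsymbol{\mu}=[\mu_0,\ldots,\mu_{k-1}]^\top$, let $\boldsymbol{\nu}=[\nu_0,\ldots,\nu_k]^\top$ with $\nu_0=\mu_0$, $\nu_k=-\mu_{k-1}$, $\nu_i=\mu_i-\mu_{i-1}$ ($1\le i\le k-1$). Generating polynomial: for $\boldsymbol{s}=[s_0,\ldots,s_r]^\top$, $M(z;\boldsymbol{s})=\sum_{i=0}^rs_iz^{r-i}$. Feasibility conditions (FP) for $(\boldsymbol{B}^{(k)},\boldsymbol{\mu},\alpha,\beta)$ with $\alpha,\beta>0$: $\sum_{i=0}^kB_i^{(k)}=1$, $\sum_{i=0}^{k-1}\mu_i=1$, and (a) $\deg M(z;\boldsymbol{a}^{(k)})=\deg M(z;\boldsymbol{\mu})=k-1$, $\deg M(z;\boldsymbol{B}^{(k)})=k$;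 (b) all roots of $M(z;\boldsymbol{\mu})$ lie in the open unit disk; (c) $M(z;\boldsymbol{a}^{(k)})$ and $M(z;\boldsymbol{\mu})$ are coprime, and $M(z;\boldsymbol{B}^{(k)})$ and $M(z;\boldsymbol{\nu})$ are coprime; (d) $P_a(x)\ge\alpha$ and $P_B(x)\ge\beta$ for all $x\in[-1,1]$, where $P_a,P_B$ are the polynomials in $x$ determined by $$P_a(\cos\theta)=\operatorname{Re}\{M(\mathrm{e}^{\mathrm{i}\theta};\boldsymbol{a}^{(k)})M(\mathrm{e}^{-\mathrm{i}\theta};\boldsymbol{\mu})\}\ (\theta\in[0,\pi]),\quad P_B(\cos\theta)=\frac{\operatorname{Re}\{M(\mathrm{e}^{\mathrm{i}\theta};\boldsymbol{B}^{(k)})M(\mathrm{e}^{-\mathrm{i}\theta};\boldsymbol{\nu})\}}{2(1-\cos\theta)}\ (\theta\in(0,\pi]),$$ $P_B$ being continuously extended to $x=1$. Positive-definiteness conditions (PDC): for all $\boldsymbol{x}\in\mathbb{R}^k$, $\boldsymbol{y}\in\mathbb{R}^{k+1}$, $\boldsymbol{x}^\top U_a\boldsymbol{x}\ge\alpha x_1^2$ and $\boldsymbol{y}^\top U_B\boldsymbol{y}\ge\beta(y_1-y_2)^2$, where ($\boldsymbol{0}_m$ the zero vector in $\mathbb{R}^m$) $$U_a=\tfrac12\big(\boldsymbol{\mu}(\boldsymbol{a}^{(k)})^\top+\boldsymbol{a}^{(k)}\boldsymbol{\mu}^\top\big)-\begin{bmatrix}G_a&\boldsymbol{0}_{k-1}\\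 \boldsymbol{0}_{k-1}^\top&0\end{bmatrix}+\begin{bmatrix}0&\boldsymbol{0}_{k-1}^\top\\ \boldsymbol{0}_{k-1}&G_a\end{bmatrix},$$ $$U_B=\tfrac12\big(\boldsymbol{\nu}(\boldsymbol{B}^{(k)})^\top+\boldsymbol{B}^{(k)}\boldsymbol{\nu}^\top\big)-\begin{bmatrix}G_B&\boldsymbol{0}_{k}\\ \boldsymbol{0}_{k}^\top&0\end{bmatrix}+\begin{bmatrix}0&\boldsymbol{0}_{k}^\top\\ \boldsymbol{0}_{k}&G_B\end{bmatrix}.$$ Modified energy. For vectors of functions and a matrix $G=(g_{ij})$, $(\boldsymbol{w},\boldsymbol{v})_G=\sum_{i,j}g_{ij}(w^i,v^j)$; linear operators act componentwise. With $\boldsymbol{v}_n=[\delta u^n,\ldots,\delta u^{n+2-k}]^\top$, $\boldsymbol{u}_n=[u^n,\ldots,u^{n+1-k}]^\top$, $$E_G^n=-\frac1\tau(\boldsymbol{v}_n,\mathcal{M}^{-1}\boldsymbol{v}_n)_{G_a}+(\boldsymbol{u}_n,\mathcal{L}\boldsymbol{u}_n)_{G_B}+\sum_{i=0}^{k-1}\mu_i(F(u^{n-i}),1)+\frac{\ell_f}{2}\sum_{i=1}^{k-1}\hat c_i\|\delta u^{n+1-i}\|^2,$$ where $\hat c_i=\sum_{j=i}^{k-1}\tilde c_j$ ($0\le i\le k-1$) and, with $\delta_{i,0}$ the Kronecker delta, $$\tilde c_i=(1-\delta_{i,0})|\hat b_i^{(k)}|\sum_{j=0}^{k-1}|\mu_j|+|\mu_i|\sum_{j=1}^{k-1}|\hat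 b_j^{(k)}|+|\mu_i|+\Big(|\mu_i|+\sum_{j=i}^{k-1}j|\mu_j|\Big)(1-\delta_{i,0}).$$ Time-step bound: with $\bar\eta=\frac{1-\eta}{\eta}$, $$\tau_{\max}=\frac{\alpha\beta^{\bar\eta}}{(\ell_f\hat c_0/2)^{1+\bar\eta}\,\eta\,(1-\eta)^{\bar\eta}\,\zeta^{2+2\bar\eta}}.$$ *)

(* Defs.v *)
From HB Require Import structures.
From Stdlib Require Import ZArith.
From mathcomp Require Import all_boot all_order all_algebra.
From mathcomp Require Import all_classical all_reals all_analysis.
From mathcomp Require Import complex.
From mathcomp.zify Require Import ssrZ.

Set Implicit Arguments.
Unset Strict Implicit.
Unset Printing Implicit Defensive.

Import Order.TTheory GRing.Theory Num.Theory.
Import numFieldNormedType.Exports.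

Local Open Scope classical_set_scope.
Local Open Scope ring_scope.

Record domain (R : realType) := Domain {
  dom_disp : measure_display;
  dom_point : measurableType dom_disp;
  dom_measure : {measure set dom_point -> \bar R};
  dom_set : set dom_point }.

Arguments dom_point {R} D : rename.
Arguments dom_measure {R} D : rename.
Arguments dom_set {R} D : rename.

(* (-pi, pi)^d with d-dimensional Lebesgue measure; d = 0 is a junk value. *)
Fixpoint cube (R : realType) (d : nat) : domain R :=
  match d with
  | (d'.+1 as d1).+1 =>
    let D := cube R d1 in
    @Domain R _ (dom_point D * measurableTypeR R)%type
      (dom_measure D \x @lebesgue_measure R)%E
      (dom_set D `*` `]- pi, pi[)
  | _ => @Domain R _ (measurableTypeR R) (@lebesgue_measure R) `]- pi, pi[
  end.

(* A Hilbert space is a complete normed space whose norm comes from an inner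
   product. *)
Definition inner_product (R : realType) (E : normedModType R)
    (ip : E -> E -> R) : Prop :=
  [/\ forall x y, ip x y = ip y x,
      forall a x y z, ip (a *: x + y) z = a * ip x z + ip y z &
      forall x, `|x| ^+ 2 = ip x x].

Definition compact_embedding (R : realType) (U W : normedModType R)
    (i : {linear U -> W}) : Prop :=
  [/\ injective i, continuous i &
      forall A : set U, bounded_set A -> compact (closure (i @` A))].

Definition dual (R : realType) (V : normedModType R) : set (V -> R^o) :=
  [set phi | linear phi /\ continuous phi].

Record gradient_flow (R : realType) (D : domain R) := GradientFlow {
  gfH : completeNormedModType R;
  gfV : completeNormedModType R;
  gfS : completeNormedModType R;
  ipH : gfH -> gfH -> R;
  ipV : gfV -> gfV -> R;
  ipS : gfS -> gfS -> R;
  ipHP : inner_product ipH;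
  ipVP : inner_product ipV;
  ipSP : inner_product ipS;
  (* [rep v] is a representative of the class v of functions on the domain.
     Linearity and injectivity of [rep], up to null sets, follow from
     [ipH_int]. *)
  rep : gfH -> dom_point D -> R;
  rep_measurable : forall v, measurable_fun (dom_set D) (rep v);
  rep_square_integrable : forall v,
    (dom_measure D).-integrable (dom_set D) (fun x => (rep v x ^+ 2)%:E);
  ipH_int : forall v w,
    ipH v w = \int[dom_measure D]_(x in dom_set D) (rep v x * rep w x);
  iSV : {linear gfS -> gfV};
  iVH : {linear gfV -> gfH};
  iSVP : compact_embedding iSV;
  iVHP : compact_embedding iVH;
  iVH_dense : dense (range iVH);
  iSH : gfS -> gfH := fun v => iVH (iSV v);
  opL : {linear gfS -> gfV};
  opL_sym : forall u v, ipH (iVH (opL u)) (iSH v) = ipH (iSH u) (iVH (opL v));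
  opL_ge0 : forall v, 0 <= ipH (iVH (opL v)) (iSH v);
  (* [opM u v] is the duality pairing of M u with v. *)
  opM : {linear gfV -> (gfV -> R^o)};
  opM_dual : forall u, dual (opM u);
  opM_sym : forall u v, opM u v = opM v u;
  bndM : R;
  coerM : R;
  bndM_gt0 : 0 < bndM;
  coerM_gt0 : 0 < coerM;
  opM_bounded : forall u v, `|opM u v| <= bndM * `|u| * `|v|;
  opM_coercive : forall v, coerM * `|v| ^+ 2 <= - opM v v;
  (* [iHV'] is the embedding of H into V'. By the Lax-Milgram theorem, opM is
     a bijection from V onto [dual], of which [invM] is the inverse; the
     default value 0 is only taken outside the dual. *)
  iHV' : gfH -> (gfV -> R^o) := fun h v => ipH h (iVH v);
  invM : (gfV -> R^o) -> gfV := 'pinv_(fun=> 0) [set: gfV] opM;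
  normL : gfS -> R := fun v => Num.sqrt (ipH (iVH (opL v)) (iSH v));
  normM : gfH -> R := fun v => Num.sqrt (ipH v (iVH (- invM (iHV' v))));
  zeta : R;
  eta : R;
  zeta_gt0 : 0 < zeta;
  eta_gt0 : 0 < eta;
  eta_le1 : eta <= 1;
  interpolation : forall v,
    `|iSH v| <= zeta * normM (iSH v) `^ eta * normL v `^ (1 - eta);
  pot : R -> R;
  pot_derivable : forall x, derivable pot x 1;
  nonlin : gfS -> gfV;
  nonlinE : forall u, {ae dom_measure D, forall x, dom_set D x ->
    rep (iVH (nonlin u)) x = (pot^`())%classic (rep (iSH u) x)};
  pot_integrable : forall u, (dom_measure D).-integrable (dom_set D)
    (fun x => (pot (rep (iSH u) x))%:E);
  energyF : gfS -> R := fun u =>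
    \int[dom_measure D]_(x in dom_set D) pot (rep (iSH u) x);
  energyF_ge0 : forall u, 0 <= energyF u;
  lipf : R;
  lipf_gt0 : 0 < lipf;
  nonlin_lipschitz : forall u v,
    `|iVH (nonlin u) - iVH (nonlin v)| <= lipf * `|iSH u - iSH v|;
  energyF_taylor : forall u v,
    `|energyF u - energyF v - ipH (iVH (nonlin v)) (iSH (u - v))|
      <= lipf / 2 * `|iSH (u - v)| ^+ 2 }.

(* Coefficient vectors are functions on nat, with the usual indices:
   A, B on 0..k, Bh on 1..k, mu on 0..k-1; values elsewhere are irrelevant. *)

Definition order_conditions (R : realType) (k : nat) (A B Bh : nat -> R) :
    Prop :=
  [/\ \sum_(0 <= i < k.+1) A i = 0,
      forall m, (m <= k.-1)%N ->
        \sum_(0 <= i < k.+1) A i * (- i%:R) ^+ m.+1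
          = m.+1%:R * \sum_(0 <= i < k.+1) B i * (- i%:R) ^+ m /\
        m.+1%:R * \sum_(0 <= i < k.+1) B i * (- i%:R) ^+ m
          = m.+1%:R * \sum_(1 <= i < k.+1) Bh i * (- i%:R) ^+ m,
      \sum_(0 <= i < k.+1) A i * (- i%:R) = 1,
      \sum_(0 <= i < k.+1) B i = 1 &
      \sum_(1 <= i < k.+1) Bh i = 1].

Definition suma (R : realType) (A : nat -> R) (i : nat) : R :=
  \sum_(0 <= j < i.+1) A j.

Definition bhat (R : realType) (Bh : nat -> R) (i : nat) : R :=
  \sum_(1 <= j < i.+1) Bh j - 1.

Definition nu_of (R : realType) (k : nat) (mu : nat -> R) (i : nat) : R :=
  if i == 0%N then mu 0%N
  else if i == k then - mu k.-1
  else mu i - mu i.-1.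

Definition ctilde (R : realType) (k : nat) (mu Bh : nat -> R) (i : nat) : R :=
  (i != 0%N)%:R * `|bhat Bh i| * (\sum_(0 <= j < k) `|mu j|)
  + `|mu i| * (\sum_(1 <= j < k) `|bhat Bh j|) + `|mu i|
  + (`|mu i| + \sum_(i <= j < k) j%:R * `|mu j|) * (i != 0%N)%:R.

Definition chat (R : realType) (k : nat) (mu Bh : nat -> R) (i : nat) : R :=
  \sum_(i <= j < k) ctilde k mu Bh j.

Definition genpoly (R : realType) (r : nat) (s : nat -> R) : {poly R} :=
  \sum_(0 <= i < r.+1) s i *: 'X^(r - i).

(* the generating polynomial with complex coefficients *)
Definition genpolyC (R : realType) (r : nat) (s : nat -> R) : {poly R[i]} :=
  map_poly (real_complex R) (genpoly r s).

Definition expi (R : realType) (t : R) : R[i] := Complex (cos t) (sin t).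

(* A polynomial is determined by its values on a nondegenerate interval, so
   "exists P" below refers to the polynomials P_a and P_B. *)
Definition feasible (R : realType) (k : nat) (A B mu : nat -> R)
    (alpha beta : R) : Prop :=
  let a := suma A in
  let nu := nu_of k mu in
  [/\ 0 < alpha /\ 0 < beta,
      \sum_(0 <= i < k.+1) B i = 1 /\ \sum_(0 <= i < k) mu i = 1,
      [/\ size (genpoly k.-1 a) = k, size (genpoly k.-1 mu) = k &
          size (genpoly k B) = k.+1],
      (forall z : R[i], root (genpolyC k.-1 mu) z -> `|z| < 1) &
      [/\ coprimep (genpoly k.-1 a) (genpoly k.-1 mu),
          coprimep (genpoly k B) (genpoly k nu),
          (exists Pa : {poly R},
            (forall t : R, 0 <= t <= pi -> Pa.[cos t] =
               complex.Re ((genpolyC k.-1 a).[expi t]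
                             * (genpolyC k.-1 mu).[expi (- t)])) /\
            (forall x : R, -1 <= x <= 1 -> alpha <= Pa.[x])) &
          (exists PB : {poly R},
            (forall t : R, 0 < t <= pi -> PB.[cos t] =
               complex.Re ((genpolyC k B).[expi t]
                             * (genpolyC k nu).[expi (- t)])
               / (2 * (1 - cos t))) /\
            (forall x : R, -1 <= x <= 1 -> beta <= PB.[x]))]].

Definition posdefmx (R : realType) (m : nat) (G : 'M[R]_m) : Prop :=
  G^T = G /\ forall x : 'cV[R]_m, x != 0 -> 0 < (x^T *m G *m x) 0 0.

Definition Umx (R : realType) (m : nat) (s t : nat -> R) (G : 'M[R]_m) :
    'M[R]_m.+1 :=
  let cs := \col_(i < m.+1) s i in
  let ct := \col_(i < m.+1) t i in
  2^-1 *: (cs *m ct^T + ct *m cs^T)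
  - castmx (addn1 m, addn1 m) (block_mx G 0 0 (0 : 'M[R]_1))
  + (block_mx (0 : 'M[R]_1) 0 0 G : 'M[R]_(1 + m)).

Definition pdc (R : realType) (k : nat) (A B mu : nat -> R) (alpha beta : R)
    (Ga : 'M[R]_k.-1) (GB : 'M[R]_k) : Prop :=
  (forall x : 'cV[R]_k.-1.+1,
     alpha * x ord0 0 ^+ 2 <= (x^T *m Umx mu (suma A) Ga *m x) 0 0) /\
  (forall y : 'cV[R]_k.+1,
     beta * (y ord0 0 - y (inord 1) 0) ^+ 2
       <= (y^T *m Umx (nu_of k mu) B GB *m y) 0 0).

Definition imex_lmm (R : realType) (D : domain R) (P : gradient_flow D)
    (k : nat) (A B Bh : nat -> R) (tau : R) (N : nat) (u : nat -> gfS P) :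
    Prop :=
  forall n, (k.-1 <= n <= N.-1)%N ->
    iHV' (iSH (\sum_(0 <= i < k.+1) A i *: u (n.+1 - i)%N))
    = tau *: opM P (\sum_(0 <= i < k.+1) B i *: opL P (u (n.+1 - i)%N)
                    + \sum_(1 <= i < k.+1) Bh i *: nonlin (u (n.+1 - i)%N)).

Definition modified_energy (R : realType) (D : domain R)
    (P : gradient_flow D) (k : nat) (mu Bh : nat -> R)
    (Ga : 'M[R]_k.-1) (GB : 'M[R]_k) (tau : R) (u : nat -> gfS P)
    (n : nat) : R :=
  let du j := u j - u j.-1 in
  - tau^-1 * (\sum_(i < k.-1) \sum_(j < k.-1) Ga i j *
      ipH (iSH (du (n - i)%N)) (iVH P (invM (iHV' (iSH (du (n - j)%N))))))
  + \sum_(i < k) \sum_(j < k) GB i j *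
      ipH (iSH (u (n - i)%N)) (iVH P (opL P (u (n - j)%N)))
  + \sum_(0 <= i < k) mu i * energyF (u (n - i)%N)
  + lipf P / 2 * \sum_(1 <= i < k)
      chat k mu Bh i * `|iSH (du (n.+1 - i)%N)| ^+ 2.

Definition tau_max (R : realType) (D : domain R) (P : gradient_flow D)
    (k : nat) (mu Bh : nat -> R) (alpha beta : R) : R :=
  let etabar := (1 - eta P) / eta P in
  alpha * beta `^ etabar
  / ((lipf P * chat k mu Bh 0 / 2) `^ (1 + etabar) * eta P
     * (1 - eta P) `^ etabar * zeta P `^ (2 + 2 * etabar)).

Definition energy_dissipation (R : realType) (k : nat)
    (A B Bh mu : nat -> R) (alpha beta : R)
    (Ga : 'M[R]_k.-1) (GB : 'M[R]_k) : Prop :=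
  forall (d : nat), (1 <= d <= 3)%N ->
  forall (P : gradient_flow (cube R d)) (T : R) (N : nat) (u : nat -> gfS P),
    0 < T -> (0 < N)%N ->
    let tau := T / N%:R in
    imex_lmm k A B Bh tau N u ->
    0 < tau <= tau_max P k mu Bh alpha beta ->
    forall n, (k.-1 <= n <= N.-1)%N ->
      modified_energy mu Bh Ga GB tau u n.+1
        <= modified_energy mu Bh Ga GB tau u n.

Definition A8 (R : realType) (i : nat) : R :=
  [:: 4369 / 840; - (581 / 30); 181 / 5; - (1327 / 30); 115 / 3; - (241 / 10);
      51 / 5; - (527 / 210); 11 / 40]`_i.

Definition B8 (R : realType) (i : nat) : R :=
  [:: 2; - 2; 0; 2; - 1; 0; 0; 0; 0]`_i.

Definition Bh8 (R : realType) (i : nat) : R :=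
  [:: 14; - 56; 114; - 141; 112; - 56; 16; - 2]`_i.-1.

Definition mu8 (R : realType) (i : nat) : R :=
  4^-1 * [:: 9; - 13; 10; 0; - 5; 6; - 4; 1]`_i.

(* Large integers are given in binary: ring_scope numerals are unary. *)
Definition ofZ (R : realType) (z : Z) : R := (int_of_Z z)%:~R.

Arguments ofZ R z%_Z_scope.

Definition mx_of_Z (R : realType) (m : nat) (rows : seq (seq Z)) : 'M[R]_m :=
  \matrix_(i < m, j < m) ofZ R (nth Z0 (nth [::] rows i) j).

Local Open Scope Z_scope.

Definition Ga8_rows : seq (seq Z) := [::
  [:: 75508; -160956; 203546; -159950; 92595; -35176; 5454];
  [:: -160956; 368482; -475338; 383138; -219714; 84760; -13766];
  [:: 203546; -475338; 628068; -513809; 296772; -113163; 19825];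
  [:: -159950; 383138; -513809; 431646; -251786; 96567; -16157];
  [:: 92595; -219714; 296772; -251786; 152167; -59983; 11044];
  [:: -35176; 84760; -113163; 96567; -59983; 26738; -5601];
  [:: 5454; -13766; 19825; -16157; 11044; -5601; 2960]].

Definition GB8_rows : seq (seq Z) := [::
  [:: 403371; -657208; 461064; 36464; -260305; 251117; -163689; 41686];
  [:: -657208; 1197243; -931714; -666; 496571; -474187; 275524; -68063];
  [:: 461064; -931714; 897993; -194792; -349955; 440110; -254248; 56542];
  [:: 36464; -666; -194792; 304571; -153239; -51486; 79210; -20062];
  [:: -260305; 496571; -349955; -153239; 404839; -290673; 105937; -15675];
  [:: 251117; -474187; 440110; -51486; -290673; 379082; -232868; 53905];
  [:: -163689; 275524; -254248; 79210; 105937; -232868; 199388; -59254];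
  [:: 41686; -68063; 56542; -20062; -15675; 53905; -59254; 23421]].

Local Close Scope Z_scope.

Definition Ga8 (R : realType) : 'M[R]_7 := (10 ^+ 4)^-1 *: mx_of_Z R 7 Ga8_rows.

Definition GB8 (R : realType) : 'M[R]_8 := (10 ^+ 5)^-1 *: mx_of_Z R 8 GB8_rows.

(* Main.v *)
Require Import Defs.
From Stdlib Require Import ZArith.
From mathcomp Require Import all_boot all_order all_algebra.
From mathcomp Require Import all_classical all_reals all_analysis.
From mathcomp Require Import complex polyrcf ring lra.
From mathcomp.zify Require Import ssrZ.

(** Everything except the arithmetic of the coefficients follows from the two
matrix inequalities x^T U_a x >= alpha x_1^2 and y^T U_B y >= beta (y_1-y_2)^2.

Let (w_i) be a sequence with a symmetric positive semidefinite Gram matrix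
K i j.  The matrix U = sym(s t^T) - diag(G,0) + diag(0,G) is built so that
its entrywise pairing with K equals

  K(sum s_i w_i, sum t_i w_i) - G(w_0, w_1, ...) + G(w_1, w_2, ...),

where G also denotes its own pairing with the Gram matrix
([Umx_contraction]).  Pairing two positive semidefinite matrices gives a
nonnegative number ([psdform_contraction]), so a matrix inequality for U is
inherited by every such K ([mx_contraction_le]).  Two sequences are used.

- Powers of a complex number z, with Re (z conj w) for K.  The two G-terms
  differ by the factor |z|^2.  At a root of the multiplier polynomial the
  product term vanishes, which forces |z| < 1; on the unit circle the G-terms
  cancel, and what remains are the lower bounds for P_a and P_B.

- The numerical solution.  Increments are paired by -M^{-1} and values by L;
  the G-terms are then the quadratic part of the modified energy at two
  consecutive times.  Testing the scheme with the multiplier combination of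
  increments turns the product terms into minus the nonlinear term
  ([scheme_tested]).  Abel summation and Lipschitz continuity compare the
  nonlinear term with the increment of the potential energy, at a cost that
  the c-hat terms of the energy transport to (l_f c-hat_0 / 2) |du|^2 for the
  newest increment du ([nonlinear_estimate], [chat_telescope]).  By
  interpolation and the weighted Young inequality this is at most
  (alpha/tau) |(-M)^{-1/2} du|^2 + beta |L^{1/2} du|^2, the dissipation
  supplied by the matrix inequalities, as soon as tau <= tau_max
  ([young_interpolation]).  That M is onto V', so that M^{-1} makes sense, is
  the Lax-Milgram theorem, obtained by minimising a quadratic functional.

The inequalities for the given matrices are certified by fraction-free
Gaussian elimination on integers ([psd_check]), and coprimality by explicit
Bezout identities. *)

Set Implicit Arguments.
Unset Strict Implicit.
Unset Printing Implicit Defensive.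
Import Order.TTheory GRing.Theory Num.Theory.
Import numFieldNormedType.Exports.
Local Open Scope ring_scope.

(** * Contraction of positive semidefinite forms *)

Definition psdform (R : realFieldType) (I : finType) (K : I -> I -> R) : Prop :=
  forall c : I -> R, 0 <= \sum_i \sum_j K i j * (c i * c j).

Lemma sum_pick (R : pzRingType) (I : finType) (p : I) (f : I -> R) :
  \sum_i (i == p)%:R * f i = f p.
Proof.
rewrite (bigD1 p) //= eqxx mul1r big1 ?addr0 // => i /negbTE ->.
by rewrite mul0r.
Qed.

(** Completing the square: the value of the Schur complement at c is the
minimum of the form over all changes of the coordinate p of c. *)
Lemma psdform_schur (R : realFieldType) (I : finType) (K : I -> I -> R) (p : I) :
  (forall i j, K i j = K j i) -> psdform K -> K p p != 0 ->
  psdform (fun i j => K i j - K p i * K p j / K p p).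
Proof.
move=> Ks Kp Kpp c.
pose r := \sum_i K p i * c i.
pose t := r / K p p.
have := Kp (fun i => c i - (i == p)%:R * t).
suff -> : \sum_i \sum_j K i j * ((c i - (i == p)%:R * t) * (c j - (j == p)%:R * t))
  = \sum_i \sum_j (K i j - K p i * K p j / K p p) * (c i * c j) by [].
have rr : \sum_i \sum_j K p i * K p j / K p p * (c i * c j) = r ^+ 2 / K p p.
  rewrite expr2 /r mulr_suml mulr_suml; apply: eq_bigr => i _.
  rewrite mulr_sumr mulr_suml; apply: eq_bigr => j _; by field.
transitivity (\sum_i \sum_j K i j * (c i * c j) - r ^+ 2 / K p p); last first.
  rewrite -rr -sumrB; apply: eq_bigr => i _; rewrite -sumrB.
  by apply: eq_bigr => j _; rewrite mulrBl.
transitivity (\sum_i (\sum_j K i j * (c i * c j)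
    - t * ((i == p)%:R * \sum_j K i j * c j)
    - t * (K p i * c i) + t ^+ 2 * ((i == p)%:R * K i p))).
  apply: eq_bigr => i _; rewrite mulr_sumr mulr_sumr -sumrB.
  rewrite -[K i p](sum_pick p (fun j => K i j)) mulr_sumr mulr_sumr.
  rewrite (Ks p i) -[K i p](sum_pick p (fun j => K i j)) mulr_suml mulr_sumr.
  rewrite -sumrB -big_split /=; apply: eq_bigr => j _; ring.
rewrite big_split /= !sumrB -!mulr_sumr.
rewrite (sum_pick p (fun i => K i p)) (sum_pick p (fun i => \sum_j K i j * c j)) -/r.
by rewrite /t; field.
Qed.

(** Otherwise the form would be affine and nonconstant, hence unbounded below,
along a line in the direction p. *)
Lemma psdform_diag0 (R : realFieldType) (I : finType) (K : I -> I -> R) (p j : I) :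
  (forall i j, K i j = K j i) -> psdform K -> K p p = 0 -> K p j = 0.
Proof.
move=> Ks Kp Kpp; apply/eqP/negPn/negP => Kpj.
(* along e_j + l e_p the form is K j j + 2 l K p j, here -1 *)
pose l := - (K j j + 1) / (2 * K p j).
have := Kp (fun i => (i == j)%:R + (i == p)%:R * l).
have -> : \sum_i \sum_i0 K i i0 * (((i == j)%:R + (i == p)%:R * l)
    * ((i0 == j)%:R + (i0 == p)%:R * l)) = K j j + K p j * l * 2.
  transitivity (\sum_i ((i == j)%:R * (K i j + K i p * l)
      + (i == p)%:R * (l * (K i j + K i p * l)))).
    apply: eq_bigr => i _; rewrite -[K i j](sum_pick j) -[K i p](sum_pick p).
    rewrite mulr_suml -big_split /= !mulr_sumr -big_split /=.
    by apply: eq_bigr => i0 _; ring.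
  rewrite big_split /= !sum_pick Kpp (Ks j p); ring.
have -> : K j j + K p j * l * 2 = - 1 by rewrite /l; field.
by rewrite ler0N1.
Qed.

(** Split off from K the rank-one matrix (K p i)(K p j) / (K p p), on which the
pairing is a value of the form U; the remainder is a Schur complement whose
row p vanishes, so induction on the set of nonzero rows applies. If K p p = 0,
row p vanishes already, by [psdform_diag0]. *)
Lemma psdform_contraction (R : realFieldType) (I : finType) (U K : I -> I -> R) :
  psdform U -> (forall i j, K i j = K j i) -> psdform K ->
  0 <= \sum_i \sum_j U i j * K i j.
Proof.
move=> Up.
suff H n : forall (S : {set I}) K, (#|S| <= n)%N ->
    (forall i j, K i j = K j i) -> psdform K ->
    (forall i j, i \notin S -> K i j = 0) -> 0 <= \sum_i \sum_j U i j * K i j.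
  move=> Ks Kp; apply: (H #|I| [set: I]) => //; first by rewrite cardsT.
  by move=> i j; rewrite inE.
elim: n => [|n IH] S {}K cS Ks Kp K0; have [S0|[p pS]] := set_0Vmem S.
- by rewrite big1 // => i _; rewrite big1 // => j _; rewrite K0 ?mulr0 // S0 inE.
- by move: cS; rewrite (cardsD1 p) pS.
- by rewrite big1 // => i _; rewrite big1 // => j _; rewrite K0 ?mulr0 // S0 inE.
- have cSp : (#|(S :\ p)%SET| <= n)%N by move: cS; rewrite (cardsD1 p) pS.
  have [Kpp|Kpp] := eqVneq (K p p) 0.
    apply: (IH (S :\ p)%SET) => // i j; rewrite !inE negb_and negbK.
    by case/orP => [/eqP ->|/K0 //]; apply: psdform_diag0.
  pose h i j := K i j - K p i * K p j / K p p.
  have hp : 0 <= \sum_i \sum_j U i j * h i j.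
    apply: (IH (S :\ p)%SET) => //; first by move=> i j; rewrite /h Ks (mulrC (K p i)).
      exact: psdform_schur.
    move=> i j; rewrite !inE negb_and negbK /h => /orP[/eqP ->|iS].
      by field.
    by rewrite (Ks p i) (K0 i j iS) (K0 i p iS) !mul0r subr0.
  have Kpp0 : 0 < K p p.
    rewrite lt_def Kpp /=; have := Kp (fun i => (i == p)%:R).
    rewrite (bigD1 p) //= (bigD1 p) //= eqxx !mulr1 !big1 ?addr0 //.
      by move=> i /negbTE ->; rewrite big1 // => j _; rewrite mul0r mulr0.
    by move=> i /negbTE ->; rewrite !mulr0.
  have -> : \sum_i \sum_j U i j * K i j = \sum_i \sum_j U i j * h i j
      + (K p p)^-1 * \sum_i \sum_j U i j * (K p i * K p j).
    rewrite mulr_sumr -big_split /=; apply: eq_bigr => i _.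
    rewrite mulr_sumr -big_split /=; apply: eq_bigr => j _.
    by rewrite /h; field.
  by rewrite addr_ge0 // mulr_ge0 ?invr_ge0 ?(ltW Kpp0) //; apply: Up.
Qed.

(** Bilinear expansions naturally produce coefficients indexed by nat. *)
Lemma psdform_of_sum (R : realFieldType) (n : nat) (K : nat -> nat -> R) :
  (forall c : nat -> R, 0 <= \sum_(i < n) \sum_(j < n) c i * c j * K i j) ->
  psdform (fun i j : 'I_n => K i j).
Proof.
move=> H c.
have [c' cE] : exists c' : nat -> R, forall i : 'I_n, c i = c' i.
  exists (fun k => if insub k is Some i then c i else 0) => i.
  by rewrite insubT //= => Hi; congr c; apply: val_inj.
have := H c'; congr (0 <= _); apply: eq_bigr => i _; apply: eq_bigr => j _.
by rewrite !cE mulrC.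
Qed.

Lemma mx_quadE (R : comNzRingType) (n : nat) (U : 'M[R]_n) (x : 'cV[R]_n) :
  (x^T *m U *m x) 0 0 = \sum_i \sum_j U i j * (x i 0 * x j 0).
Proof.
rewrite mxE exchange_big /=; apply: eq_bigr => j _.
rewrite mxE mulr_suml; apply: eq_bigr => i _; rewrite mxE; ring.
Qed.

(** A lower bound for a quadratic form over the reals carries over to vectors
in any space with a positive semidefinite pairing K. *)
Lemma mx_contraction_le (R : realFieldType) (n : nat) (U : 'M[R]_n)
    (gamma : R) (l : 'I_n -> R) (K : 'I_n -> 'I_n -> R) :
  (forall x : 'cV[R]_n,
     gamma * (\sum_i l i * x i 0) ^+ 2 <= (x^T *m U *m x) 0 0) ->
  (forall i j, K i j = K j i) -> psdform K ->
  gamma * (\sum_i \sum_j l i * l j * K i j) <= \sum_i \sum_j U i j * K i j.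
Proof.
move=> HU Ks Kp; rewrite -subr_ge0.
have := @psdform_contraction _ _ (fun i j => U i j - gamma * (l i * l j)) K _ Ks Kp.
suff -> : \sum_i \sum_j (U i j - gamma * (l i * l j)) * K i j
  = \sum_i \sum_j U i j * K i j - gamma * (\sum_i \sum_j l i * l j * K i j).
  apply=> c; have := HU (\col_i c i); rewrite mx_quadE -subr_ge0.
  congr (0 <= _); rewrite expr2 mulr_suml mulr_sumr -sumrB.
  apply: eq_bigr => i _; rewrite mulr_sumr mulr_sumr -sumrB.
  by apply: eq_bigr => j _; rewrite !mxE; ring.
rewrite mulr_sumr -sumrB; apply: eq_bigr => i _.
rewrite mulr_sumr -sumrB; apply: eq_bigr => j _; ring.
Qed.

(** * The quadratic form of a shifted pair of matrices *)

Lemma castmx_sum (R : pzRingType) (m n : nat) (e : m = n) (M : 'M[R]_m)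
    (K : nat -> nat -> R) :
  \sum_(i < n) \sum_(j < n) castmx (e, e) M i j * K i j
  = \sum_(i < m) \sum_(j < m) M i j * K i j.
Proof. by case: n / e; rewrite castmx_id. Qed.

Lemma block_ul_sum (R : pzRingType) (m n : nat) (G : 'M[R]_m) (K : nat -> nat -> R) :
  \sum_(i < m + n) \sum_(j < m + n) block_mx G 0 0 (0 : 'M[R]_n) i j * K i j
  = \sum_(i < m) \sum_(j < m) G i j * K i j.
Proof.
rewrite big_split_ord /= [X in _ + X]big1 ?addr0; last first.
  move=> i _; rewrite big_split_ord /= !big1 ?addr0 // => j _.
    by rewrite block_mxEdr mxE mul0r.
  by rewrite block_mxEdl mxE mul0r.
apply: eq_bigr => i _; rewrite big_split_ord /= [X in _ + X]big1 ?addr0.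
  by apply: eq_bigr => j _; rewrite block_mxEul.
by move=> j _; rewrite block_mxEur mxE mul0r.
Qed.

Lemma block_dr_sum (R : pzRingType) (m n : nat) (G : 'M[R]_m) (K : nat -> nat -> R) :
  \sum_(i < n + m) \sum_(j < n + m) block_mx (0 : 'M[R]_n) 0 0 G i j * K i j
  = \sum_(i < m) \sum_(j < m) G i j * K (n + i)%N (n + j)%N.
Proof.
rewrite big_split_ord /= big1 ?add0r; last first.
  move=> i _; rewrite big_split_ord /= !big1 ?addr0 // => j _.
    by rewrite block_mxEur mxE mul0r.
  by rewrite block_mxEul mxE mul0r.
apply: eq_bigr => i _; rewrite big_split_ord /= big1 ?add0r.
  by apply: eq_bigr => j _; rewrite block_mxEdr.
by move=> j _; rewrite block_mxEdl mxE mul0r.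
Qed.

(** When K is the Gram matrix of (w_i), the last sum is the G-form of the
shifted sequence (w_{i+1}), so the two G-terms telescope in time. *)
Lemma Umx_contraction (R : realType) (m : nat) (s t : nat -> R) (G : 'M[R]_m)
    (K : nat -> nat -> R) :
  (forall i j, K i j = K j i) ->
  \sum_(i < m.+1) \sum_(j < m.+1) Umx s t G i j * K i j
  = \sum_(i < m.+1) \sum_(j < m.+1) s i * t j * K i j
    - \sum_(i < m) \sum_(j < m) G i j * K i j
    + \sum_(i < m) \sum_(j < m) G i j * K i.+1 j.+1.
Proof.
move=> Ks.
rewrite -(block_ul_sum 1 G K) -(castmx_sum (addn1 m)).
have shift : \sum_(i < m.+1) \sum_(j < m.+1)
      (block_mx (0 : 'M[R]_1) 0 0 G : 'M[R]_(1 + m)) i j * K i j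
    = \sum_(i < m) \sum_(j < m) G i j * K i.+1 j.+1 := block_dr_sum 1 G K.
rewrite -shift.
have -> : \sum_(i < m.+1) \sum_(j < m.+1) s i * t j * K i j
  = 2^-1 * \sum_(i < m.+1) \sum_(j < m.+1) (s i * t j + t i * s j) * K i j.
  have E : \sum_(i < m.+1) \sum_(j < m.+1) (s i * t j + t i * s j) * K i j
    = \sum_(i < m.+1) \sum_(j < m.+1) s i * t j * K i j
      + \sum_(i < m.+1) \sum_(j < m.+1) t i * s j * K i j.
    rewrite -big_split; apply: eq_bigr => i _; rewrite -big_split /=.
    by apply: eq_bigr => j _; rewrite mulrDl.
  have -> : \sum_(i < m.+1) \sum_(j < m.+1) (s i * t j + t i * s j) * K i j
    = 2 * \sum_(i < m.+1) \sum_(j < m.+1) s i * t j * K i j.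
    rewrite E mulr_natl mulr2n; congr (_ + _).
    rewrite exchange_big; apply: eq_bigr => i _; apply: eq_bigr => j _.
    by rewrite (Ks j i) (mulrC (t j)).
  by rewrite mulKf // pnatr_eq0.
rewrite mulr_sumr -sumrB -big_split /=; apply: eq_bigr => i _.
rewrite mulr_sumr -sumrB -big_split /=; apply: eq_bigr => j _.
by rewrite /Umx !mxE !big_ord1 !mxE; ring.
Qed.

(** * Geometric sequences: roots and trigonometric bounds *)

Lemma size_genpoly (R : realType) (r : nat) (s : nat -> R) :
  s 0%N != 0 -> size (genpoly r s) = r.+1.
Proof.
move=> s0; rewrite /genpoly big_nat_recl // subn0.
rewrite size_polyDl size_scale ?size_polyXn //.
apply: leq_ltn_trans (leqnn r.+1).
apply: (leq_trans (size_sum _ _ _)); apply/bigmax_leqP_seq => i.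
rewrite mem_index_iota => /andP[_ ir] _.
by rewrite (leq_trans (size_scale_leq _ _)) // size_polyXn ltn_subrL /= (leq_ltn_trans _ ir).
Qed.

Lemma horner_genpolyC (R : realType) (r : nat) (s : nat -> R) (z : R[i]) :
  (genpolyC r s).[z] = \sum_(i < r.+1) real_complex R (s i) * z ^+ (r - i).
Proof.
rewrite /genpolyC /genpoly big_mkord rmorph_sum horner_sum.
by apply: eq_bigr => i _; rewrite /= map_polyZ map_polyXn hornerZ hornerXn.
Qed.

Lemma Re_lincomb (R : rcfType) (n : nat) (s : nat -> R) (w : nat -> R[i]) :
  complex.Re (\sum_(i < n) real_complex R (s i) * w i)
  = \sum_(i < n) s i * complex.Re (w i).
Proof.
elim: n => [|n IH]; first by rewrite !big_ord0.
rewrite !big_ord_recr /= -IH; case: (\sum_(i < n) _) (w n) => a b [c d] /=.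
by rewrite mul0r subr0.
Qed.

Lemma Im_lincomb (R : rcfType) (n : nat) (s : nat -> R) (w : nat -> R[i]) :
  complex.Im (\sum_(i < n) real_complex R (s i) * w i)
  = \sum_(i < n) s i * complex.Im (w i).
Proof.
elim: n => [|n IH]; first by rewrite !big_ord0.
rewrite !big_ord_recr /= -IH; case: (\sum_(i < n) _) (w n) => a b [c d] /=.
by rewrite mul0r addr0.
Qed.

(** The real part of z times the conjugate of w, i.e. the Euclidean inner
product of the plane. *)
Definition reip (R : rcfType) (z w : R[i]) : R :=
  complex.Re z * complex.Re w + complex.Im z * complex.Im w.

Lemma reipC (R : rcfType) (z w : R[i]) : reip z w = reip w z.
Proof. by rewrite /reip (mulrC (complex.Re z)) (mulrC (complex.Im z)). Qed.

Lemma reip_mull (R : rcfType) (z v w : R[i]) :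
  reip (z * v) (z * w) = reip z z * reip v w.
Proof. by case: z v w => [a b] [c d] [e f]; rewrite /reip /=; ring. Qed.

Lemma reip_lincomb (R : rcfType) (n : nat) (s t : nat -> R) (w : nat -> R[i]) :
  \sum_(i < n) \sum_(j < n) s i * t j * reip (w i) (w j)
  = reip (\sum_(i < n) real_complex R (s i) * w i)
         (\sum_(i < n) real_complex R (t i) * w i).
Proof.
rewrite /reip !Re_lincomb !Im_lincomb !mulr_suml -big_split /=.
apply: eq_bigr => i _; rewrite !mulr_sumr -big_split /=.
by apply: eq_bigr => j _; ring.
Qed.

Lemma reip_psdform (R : rcfType) (n : nat) (w : nat -> R[i]) :
  psdform (fun i j : 'I_n => reip (w i) (w j)).
Proof.
apply: (@psdform_of_sum _ _ (fun i j => reip (w i) (w j))) => c.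
by rewrite reip_lincomb /reip -!expr2 addr_ge0 ?sqr_ge0.
Qed.

(** The sequence z^m, ..., z, 1 is z times its shift, so the two G-terms are
proportional with ratio |z|^2. *)
Lemma genpoly_multiplier_le (R : realType) (m : nat) (s t : nat -> R) (G : 'M[R]_m)
    (gamma : R) (l : 'I_m.+1 -> R) (z : R[i]) :
  let w i := z ^+ (m - i) in
  let Q := \sum_(i < m) \sum_(j < m) G i j * reip (w i.+1) (w j.+1) in
  (forall x : 'cV[R]_m.+1,
     gamma * (\sum_i l i * x i 0) ^+ 2 <= (x^T *m Umx s t G *m x) 0 0) ->
  gamma * (\sum_i \sum_j l i * l j * reip (w i) (w j))
    <= reip (genpolyC m s).[z] (genpolyC m t).[z] + (1 - reip z z) * Q.
Proof.
move=> w Q H.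
have := mx_contraction_le H (fun i j => reipC (w i) (w j)) (@reip_psdform R _ w).
rewrite (Umx_contraction s t G (fun i j => reipC (w i) (w j))) reip_lincomb.
rewrite !horner_genpolyC -/w => /le_trans; apply.
rewrite -addrA lerD2l mulrBl mul1r addrC lerD2l lerN2 /Q mulr_sumr.
apply: ler_sum => i _; rewrite mulr_sumr; apply: ler_sum => j _.
have wS (k : 'I_m) : w k = z * w k.+1 by rewrite /w -exprS subnSK.
by rewrite !wS reip_mull mulrCA.
Qed.

Lemma ltc1_reip (R : rcfType) (z : R[i]) : reip z z < 1 -> `|z| < 1.
Proof.
move=> z1; rewrite normc_def ltcR -sqrtr1 ltr_sqrt // !expr2; exact: z1.
Qed.

Lemma reip_exp (R : rcfType) (z : R[i]) (n : nat) :
  reip (z ^+ n) (z ^+ n) = reip z z ^+ n.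
Proof.
elim: n => [|n IH]; first by rewrite !expr0 /reip /= mulr1 mulr0 addr0.
by rewrite !exprS reip_mull IH.
Qed.

(** At a root the product term vanishes: alpha |z|^(2m) <= (1 - |z|^2) Q with
Q >= 0, which is impossible when |z| >= 1. *)
Lemma multiplier_root_lt1 (R : realType) (m : nat) (s t : nat -> R) (G : 'M[R]_m)
    (alpha : R) (z : R[i]) :
  0 < alpha -> (forall x : 'cV[R]_m, 0 <= (x^T *m G *m x) 0 0) ->
  (forall x : 'cV[R]_m.+1,
     alpha * x ord0 0 ^+ 2 <= (x^T *m Umx s t G *m x) 0 0) ->
  root (genpolyC m s) z -> `|z| < 1.
Proof.
move=> a0 Gp H /rootP zr; apply: ltc1_reip; rewrite ltNge; apply/negP => z1.
have := @genpoly_multiplier_le R m s t G alpha (fun i => (i == ord0)%:R) z.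
rewrite /= => /(_ _)/wrap[x|]; first by rewrite sum_pick.
under eq_bigr do under eq_bigr do rewrite -mulrA.
under eq_bigr do rewrite -mulr_sumr sum_pick.
rewrite sum_pick subn0 reip_exp zr {2}/reip !mul0r !add0r leNgt => /negP; apply.
apply: (@le_lt_trans _ _ 0); last by rewrite mulr_gt0 // exprn_gt0 // (lt_le_trans _ z1).
rewrite mulr_le0_ge0 ?subr_le0 //.
(* nonnegativity of the G-term: contraction with the trivial bound 0 *)
have := @mx_contraction_le _ _ G 0 (fun=> 0) (fun i j => reip (z ^+ (m - i.+1)) (z ^+ (m - j.+1))).
rewrite !mul0r; apply=> [x|i j|].
- by rewrite mul0r.
- by rewrite reipC.
- exact: (@reip_psdform _ _ (fun i => z ^+ (m - i.+1))).
Qed.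

Lemma expiX (R : realType) (t : R) (n : nat) : expi t ^+ n = expi (n%:R * t).
Proof.
elim: n => [|n IH]; first by rewrite mul0r /expi cos0 sin0.
rewrite exprS IH -natr1 mulrDl mul1r addrC /expi cosD sinD.
by congr Complex; rewrite [RHS]addrC.
Qed.

Lemma expiN (R : realType) (t : R) : expi (- t) = conjc (expi t).
Proof. by rewrite /expi cosN sinN. Qed.

Lemma reip_expi (R : realType) (s t : R) : reip (expi s) (expi t) = cos (s - t).
Proof. by rewrite /reip cosB. Qed.

Lemma Re_mul_conj (R : rcfType) (z w : R[i]) : complex.Re (z * conjc w) = reip z w.
Proof. by case: z w => [a b] [c d]; rewrite /reip /= mulrN opprK. Qed.

Lemma genpolyC_conj (R : realType) (r : nat) (s : nat -> R) (z : R[i]) :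
  (genpolyC r s).[conjc z] = conjc (genpolyC r s).[z].
Proof.
rewrite !horner_genpolyC rmorph_sum /=; apply: eq_bigr => i _.
by rewrite rmorphM rmorphXn; congr (_ * _); rewrite /= oppr0.
Qed.

Lemma chebyshev_ex (R : realType) (n : nat) :
  exists T : {poly R}, forall t, T.[cos t] = cos (n%:R * t).
Proof.
suff [T [T' [H _]]] : exists T T' : {poly R},
    (forall t, T.[cos t] = cos (n%:R * t)) /\
    (forall t, T'.[cos t] = cos (n.+1%:R * t)) by exists T.
(* cos ((n+2) t) = 2 cos t cos ((n+1) t) - cos (n t) *)
elim: n => [|n [T [T' [HT HT']]]].
  exists 1, 'X; split=> t; rewrite ?hornerC ?hornerX ?mul1r //.
  by rewrite mul0r cos0.
exists T', (2 *: ('X * T') - T); split=> // t.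
rewrite hornerD hornerN hornerZ hornerM hornerX HT HT'.
have -> : n%:R * t = n.+1%:R * t - t by rewrite -[n.+1%:R]natr1; ring.
have -> : n.+2%:R * t = n.+1%:R * t + t by rewrite -[n.+2%:R]natr1; ring.
rewrite cosB cosD; ring.
Qed.

(** The product is a combination of the numbers cos ((p - q) x), which are
Chebyshev polynomials in cos x. *)
Lemma genpoly_product_cos_ex (R : realType) (r : nat) (s t : nat -> R) :
  exists P : {poly R}, forall x, P.[cos x]
    = complex.Re ((genpolyC r s).[expi x] * (genpolyC r t).[expi (- x)]).
Proof.
have chebB (p q : nat) : exists T : {poly R},
    forall x, T.[cos x] = reip (expi x ^+ p) (expi x ^+ q).
  wlog pq : p q / (q <= p)%N.
    move=> H; case: (leqP q p) => [/H //|/ltnW /H [T HT]].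
    by exists T => x; rewrite HT reipC.
  have [T HT] := chebyshev_ex R (p - q); exists T => x.
  by rewrite HT !expiX reip_expi natrB // mulrBl.
have [T HT] := choice (fun pq => chebB pq.1 pq.2).
exists (\sum_(i < r.+1) \sum_(j < r.+1) (s i * t j) *: T (r - i, r - j)%N) => x.
rewrite expiN genpolyC_conj Re_mul_conj !horner_genpolyC.
rewrite -(reip_lincomb r.+1 s t (fun i => expi x ^+ (r - i))).
rewrite horner_sum; apply: eq_bigr => i _; rewrite horner_sum.
by apply: eq_bigr => j _; rewrite hornerZ HT.
Qed.

Lemma poly_ge_right (R : realType) (p : {poly R}) (b : R) :
  (forall x, -1 <= x < 1 -> b <= p.[x]) -> b <= p.[1].
Proof.
move=> H; rewrite leNgt; apply/negP => p1.
have bp : 0 < b - p.[1] by rewrite subr_gt0.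
have [d d0 Hd] := @poly_cont _ 1 p _ bp.
pose e := Num.min (d / 2) 1.
have e0 : 0 < e by rewrite lt_min divr_gt0 // ltr01.
have ed : e < d by rewrite gt_min ltr_pdivrMr // ltr_pMr // ltr1n.
have e1 : e <= 1 by rewrite ge_min lexx orbT.
have := Hd (1 - e); rewrite addrAC subrr add0r normrN gtr0_norm // => /(_ ed).
have : b <= p.[1 - e] by apply: H; apply/andP; split; lra.
move=> h1 /(le_lt_trans (ler_norm _)); lra.
Qed.

Lemma reip_expi1 (R : realType) (t : R) : reip (expi t) (expi t) = 1.
Proof. by rewrite reip_expi subrr cos0. Qed.

Lemma cos_onto (R : realType) (x : R) : -1 <= x <= 1 ->
  exists2 t, 0 <= t <= pi & cos t = x.
Proof.
move=> x1; exists (acos x); last by rewrite acosK.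
by rewrite acos_ge0 ?acos_lepi.
Qed.

(** On the unit circle the G-terms of [genpoly_multiplier_le] cancel. *)
Lemma product_polynomial_ge (R : realType) (m : nat) (s t : nat -> R) (G : 'M[R]_m)
    (alpha : R) :
  (forall x : 'cV[R]_m.+1,
     alpha * x ord0 0 ^+ 2 <= (x^T *m Umx s t G *m x) 0 0) ->
  exists P : {poly R},
    (forall x : R, 0 <= x <= pi -> P.[cos x]
       = complex.Re ((genpolyC m t).[expi x] * (genpolyC m s).[expi (- x)])) /\
    (forall x : R, -1 <= x <= 1 -> alpha <= P.[x]).
Proof.
move=> H; have [P HP] := genpoly_product_cos_ex m t s.
exists P; split=> [x _|_ /cos_onto[x _ <-]]; rewrite HP //.
rewrite expiN genpolyC_conj Re_mul_conj reipC.
have := @genpoly_multiplier_le R m s t G alpha (fun i => (i == ord0)%:R) (expi x).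
rewrite /= => /(_ _)/wrap[y|]; first by rewrite sum_pick.
under eq_bigr do under eq_bigr do rewrite -mulrA.
under eq_bigr do rewrite -mulr_sumr sum_pick.
by rewrite sum_pick reip_exp reip_expi1 subrr mul0r addr0 expr1n mulr1.
Qed.

Lemma inord1_neq0 (m : nat) : (inord 1 : 'I_m.+2) != ord0.
Proof. by apply/eqP => /(congr1 val) /=; rewrite inordK. Qed.

Lemma sum_diff01 (R : pzRingType) (m : nat) (f : 'I_m.+2 -> R) :
  \sum_i ((i == ord0)%:R - (i == inord 1)%:R) * f i = f ord0 - f (inord 1).
Proof.
rewrite (bigD1 ord0) //= (bigD1 (inord 1)) ?inord1_neq0 //= big1.
  rewrite addr0 eqxx (negbTE (inord1_neq0 m)) eq_sym (negbTE (inord1_neq0 m)).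
  by rewrite subr0 mul1r sub0r mulN1r.
by move=> i /andP[/negbTE -> /negbTE ->]; rewrite subr0 mul0r.
Qed.

(** The numerator Q vanishes at x = 1 because the s_i sum to 0, so 1 - x divides
it. On the unit circle |w_0 - w_1|^2 = 2 (1 - cos t), so the bound for U is
exactly the bound for the quotient; it extends to x = 1 by continuity. *)
Lemma product_quotient_polynomial_ge (R : realType) (m : nat) (s t : nat -> R)
    (G : 'M[R]_m.+1) (beta : R) :
  \sum_(i < m.+2) s i = 0 ->
  (forall y : 'cV[R]_m.+2,
     beta * (y ord0 0 - y (inord 1) 0) ^+ 2 <= (y^T *m Umx s t G *m y) 0 0) ->
  exists P : {poly R},
    (forall x : R, 0 < x <= pi -> P.[cos x]
       = complex.Re ((genpolyC m.+1 t).[expi x] * (genpolyC m.+1 s).[expi (- x)])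
           / (2 * (1 - cos x))) /\
    (forall x : R, -1 <= x <= 1 -> beta <= P.[x]).
Proof.
move=> s0 H; have [Q HQ] := genpoly_product_cos_ex m.+1 t s.
have : root Q 1.
  have Q1 := HQ 0; rewrite cos0 oppr0 /expi cos0 sin0 in Q1; apply/rootP.
  rewrite Q1 (horner_genpolyC _ s) (_ : \sum_(i < _) _ = 0) ?mulr0 //.
  transitivity (real_complex R (\sum_(i < m.+2) s i)); last by rewrite s0.
  by rewrite rmorph_sum; apply: eq_bigr => i _; rewrite /= expr1n mulr1.
case/factor_theorem => q Qq; exists ((- 2^-1) *: q).
have PE x : x != 1 -> ((- 2^-1) *: q).[x] = Q.[x] / (2 * (1 - x)).
  move=> x1; rewrite Qq hornerZ hornerM hornerXsubC; field.
  by rewrite subr_eq0 eq_sym x1.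
have lb x : -1 <= x < 1 -> beta <= ((- 2^-1) *: q).[x].
  case/andP => xm1 x1; rewrite PE ?lt_eqF // ler_pdivlMr; last first.
    by rewrite mulr_gt0 // subr_gt0.
  have /cos_onto[u _ ux] : -1 <= x <= 1 by rewrite xm1 ltW.
  rewrite -ux HQ expiN genpolyC_conj Re_mul_conj reipC.
  have := @genpoly_multiplier_le R m.+1 s t G beta
    (fun i => (i == ord0)%:R - (i == inord 1)%:R) (expi u).
  rewrite /= => /(_ _)/wrap[y|]; first by rewrite sum_diff01.
  under eq_bigr do under eq_bigr do rewrite -mulrA.
  under eq_bigr do rewrite -mulr_sumr sum_diff01.
  rewrite sum_diff01 inordK // subn0 subSS subn0 reip_expi1 subrr mul0r addr0.
  rewrite !reip_exp reip_expi1 !expr1n (reipC (expi u ^+ m)) !expiX reip_expi.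
  rewrite (_ : m.+1%:R * u - m%:R * u = u); first by apply: le_trans; lra.
  by rewrite -natr1; ring.
split=> x /andP[x0 x1].
  rewrite PE ?HQ //; apply/eqP => c1.
  have : acos (cos x) = x by rewrite cosK // in_itv /= x1 ltW.
  by rewrite c1 acos1 => x00; rewrite -x00 ltxx in x0.
move: x1; rewrite le_eqVlt => /orP[/eqP ->|x1]; first exact: poly_ge_right.
by rewrite lb ?x0.
Qed.

(** * The Lax-Milgram theorem for symmetric forms *)

Local Open Scope classical_set_scope.
Local Open Scope ring_scope.

(** A minimising sequence of J v = a(v,v) - 2 phi(v) is Cauchy by the
parallelogram identity and coercivity. Near-minimality makes the derivative
2 (a(v_n,w) - phi(w)) of J in each direction w tend to 0, so the limit u
satisfies a(u,w) = phi(w). *)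
Lemma lax_milgram_sym (R : realType) (V : completeNormedModType R)
    (a : V -> V -> R) (phi : V -> R) (C c M : R) :
  (forall x y, a x y = a y x) ->
  (forall k x y z, a (k *: x + y) z = k * a x z + a y z) ->
  (forall k x y, phi (k *: x + y) = k * phi x + phi y) ->
  0 < c -> (forall x y, `|a x y| <= C * `|x| * `|y|) ->
  (forall x, c * `|x| ^+ 2 <= a x x) -> (forall x, `|phi x| <= M * `|x|) ->
  exists u, forall v, a u v = phi v.
Proof.
move=> asym alin philin c0 aC ac phiM.
have alinr k x y z : a z (k *: x + y) = k * a z x + a z y.
  by rewrite asym alin !(asym z).
have perturbation (X Y Jv m' p : R) :
    m' <= Jv + - (2 * X) + Y -> Y <= X -> Jv < m' + p -> X <= p by move=> *; lra.
have parallelogram (jx jy m' A B ex ey : R) :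
    m' <= jy + 2 * 2^-1 * B + 2^-1 ^+ 2 * A -> jx = jy + 2 * 1 * B + 1 ^+ 2 * A ->
    jx < m' + ex -> jy < m' + ey -> A <= 2 * (ex + ey) by move=> *; lra.
pose J v := a v v - 2 * phi v.
have JE (x y : V) k : J (k *: x + y) = J y + 2 * k * (a y x - phi x) + k ^+ 2 * a x x.
  rewrite /J alin !alinr philin (asym x y); ring.
have Jlb : has_inf (range J).
  split; first by exists (J 0), 0.
  exists (- (M ^+ 2 / c)) => _ [v _ <-].
  have h1 := ac v; have h2 := phiM v; rewrite /J.
  have h3 : phi v <= M * `|v| := le_trans (ler_norm _) h2.
  have h4 : 0 <= (c * `|v| - M) ^+ 2 / c by rewrite divr_ge0 ?sqr_ge0 ?ltW.
  have h5 : (c * `|v| - M) ^+ 2 / c = c * `|v| ^+ 2 - 2 * (M * `|v|) + M ^+ 2 / c.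
    by field; rewrite gt_eqF.
  lra.
pose m := inf (range J).
have Jm v : m <= J v by apply: ge_inf; [exact: (proj2 Jlb) | exists v].
have near_min (n : nat) : exists v, J v < m + n.+1%:R^-1.
  have [_ [v _ <-] Hv] := @inf_adherent _ (range J) (n.+1%:R^-1) (ltac:(by rewrite invr_gt0)) Jlb.
  by exists v.
have [v Jv] := choice near_min.
have dist x y ex ey : J x < m + ex -> J y < m + ey -> c * `|x - y| ^+ 2 <= 2 * (ex + ey).
  move=> hx hy; apply: (le_trans (ac _)).
  have h1 := Jm (2^-1 *: (x - y) + y); rewrite JE in h1.
  have h2 := JE (x - y) y 1; rewrite scale1r subrK in h2.
  exact: parallelogram h1 h2 hx hy.
have Hcau : cvg (v @ \oo).
  apply/cauchy_cvgP/cauchy_exP => e e0.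
  have /ltr_add_invr [N] : 0 < c * e ^+ 2 / 4 by rewrite divr_gt0 ?mulr_gt0 ?exprn_gt0.
  rewrite add0r => HN; exists (v N); exists N => // n /= Nn.
  rewrite -ball_normE /ball_ /=.
  rewrite -(@ltr_pXn2r _ 2%N) // ?nnegrE ?(ltW e0) // -(ltr_pM2l c0).
  apply: (le_lt_trans (dist _ _ _ _ (Jv N) (Jv n))).
  have : (n.+1%:R : R)^-1 <= N.+1%:R^-1 by rewrite lef_pV2 ?posrE // ler_nat.
  by move: HN; move: N.+1%:R^-1 n.+1%:R^-1 => p q *; lra.
pose u := lim (v @ \oo); exists u => w; apply/eqP; rewrite -subr_eq0 -normr_le0.
apply/ler_addgt0Pl => e e0; rewrite addr0.
pose D := C * `|w| * `|w| + 1.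
have D0 : 0 < D.
  have := aC w w; have := ac w; have := ler_norm (a w w).
  have : 0 <= c * `|w| ^+ 2 by rewrite mulr_ge0 ?(ltW c0) ?sqr_ge0.
  rewrite /D; lra.
have g_small n : (a (v n) w - phi w) ^+ 2 <= D * n.+1%:R^-1.
  set g := a (v n) w - phi w.
  (* D bounds a(w,w), so the step -g/D along w lowers J by at least g^2/D *)
  have h1 := Jm ((- (g / D)) *: w + v n).
  have h2 := JE w (v n) (- (g / D)); have h3 := Jv n.
  rewrite -/g in h2.
  have h4 : a w w <= D.
    by have := aC w w; have := ler_norm (a w w); rewrite /D; lra.
  have h5 : (- (g / D)) ^+ 2 * a w w <= (- (g / D)) ^+ 2 * D.
    by rewrite ler_wpM2l ?sqr_ge0.
  have h6 : (- (g / D)) ^+ 2 * D = g ^+ 2 / D by field; rewrite gt_eqF.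
  have h7 : 2 * - (g / D) * g = - (2 * (g ^+ 2 / D)) by field; rewrite gt_eqF.
  rewrite h7 in h2; rewrite h6 in h5; rewrite h2 in h1.
  have : g ^+ 2 / D <= n.+1%:R^-1 by exact: perturbation h1 h5 h3.
  by rewrite ler_pdivrMr // mulrC.
have Cw0 : 0 <= C * `|w|.
  have [->|w0] := eqVneq w 0; first by rewrite normr0 mulr0.
  have wp : 0 < `|w| by rewrite normr_gt0.
  by rewrite -(pmulr_lge0 _ wp) (le_trans _ (aC w w)).
have v_to_u (r : R) : 0 < r -> \forall n \near \oo, `|u - v n| <= r.
  by move=> r0; have /cvgrPdist_le := Hcau; apply.
have small : \forall n \near \oo, `|a u w - phi w| <= e.
  near=> n.
  have h1 : `|a u w - a (v n) w| <= e / 2.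
    have -> : a u w - a (v n) w = a (u - v n) w.
      by rewrite -(scaleN1r (v n)) (addrC u) alin; ring.
    apply: (le_trans (aC _ _)); rewrite mulrAC.
    apply: (@le_trans _ _ ((C * `|w| + 1) * `|u - v n|)).
      by rewrite ler_wpM2r // lerDl.
    have k0 : 0 < C * `|w| + 1 by rewrite ltr_wpDl.
    rewrite -ler_pdivlMl //.
    near: n; apply: v_to_u; rewrite mulr_gt0 ?invr_gt0 ?divr_gt0 //.
    by rewrite ltr_wpDl.
  have h2 : `|a (v n) w - phi w| <= e / 2.
    rewrite -(@ler_pXn2r _ 2%N) // ?nnegrE ?divr_ge0 ?(ltW e0) // real_normK ?num_real //.
    apply: (le_trans (g_small n)); rewrite -ler_pdivlMl //; near: n.
    have /ltr_add_invr [N] : 0 < D^-1 * (e / 2) ^+ 2.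
      by rewrite mulr_gt0 ?invr_gt0 ?exprn_gt0 ?divr_gt0.
    rewrite add0r => HN; exists N => // n /= Nn; apply: le_trans (ltW HN).
    by rewrite lef_pV2 ?posrE // ler_nat.
  have -> : a u w - phi w = (a u w - a (v n) w) + (a (v n) w - phi w) by ring.
  by apply: (le_trans (ler_normD _ _)); lra.
by have [n _ /(_ n)] := small; apply => /=.
Unshelve. all: by end_near. Qed.

Local Close Scope classical_set_scope.

(** * Inner products and the nonlinear term *)

Lemma ip0l (R : realType) (E : normedModType R) (ip : E -> E -> R) (z : E) :
  inner_product ip -> ip 0 z = 0.
Proof. by case=> _ ipl _; have := ipl 1 0 0 z; rewrite scaler0 addr0; lra. Qed.

Lemma ipDl (R : realType) (E : normedModType R) (ip : E -> E -> R) (x y z : E) :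
  inner_product ip -> ip (x + y) z = ip x z + ip y z.
Proof. by case=> _ ipl _; rewrite -[x]scale1r ipl mul1r scale1r. Qed.

Lemma ipZl (R : realType) (E : normedModType R) (ip : E -> E -> R) a (x z : E) :
  inner_product ip -> ip (a *: x) z = a * ip x z.
Proof. by move=> ipP; have [_ ipl _] := ipP; rewrite -[a *: x]addr0 ipl ip0l // addr0. Qed.

Lemma ipBl (R : realType) (E : normedModType R) (ip : E -> E -> R) (x y z : E) :
  inner_product ip -> ip (x - y) z = ip x z - ip y z.
Proof. by move=> ipP; rewrite -scaleN1r ipDl // ipZl // mulN1r. Qed.

Lemma ip_suml (R : realType) (E : normedModType R) (ip : E -> E -> R) (I : Type)
    (r : seq I) (c : I -> R) (x : I -> E) (z : E) :
  inner_product ip ->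
  ip (\sum_(i <- r) c i *: x i) z = \sum_(i <- r) c i * ip (x i) z.
Proof.
move=> ipP; elim: r => [|i r IH]; first by rewrite !big_nil ip0l.
by rewrite !big_cons ipDl // ipZl // IH.
Qed.

Lemma ip_sumr (R : realType) (E : normedModType R) (ip : E -> E -> R) (I : Type)
    (r : seq I) (c : I -> R) (x : I -> E) (z : E) :
  inner_product ip ->
  ip z (\sum_(i <- r) c i *: x i) = \sum_(i <- r) c i * ip z (x i).
Proof.
move=> ipP; have [ipC _ _] := ipP.
by rewrite ipC ip_suml //; apply: eq_bigr => i _; rewrite ipC.
Qed.

(** Expand the square of the norm of |y|^2 x - (x,y) y. *)
Lemma cauchy_schwarz (R : realType) (E : normedModType R) (ip : E -> E -> R) (x y : E) :
  inner_product ip -> `|ip x y| <= `|x| * `|y|.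
Proof.
move=> ipP; have [ipC _ ipn] := ipP.
have [->|y0] := eqVneq y 0; first by rewrite ipC ip0l // !normr0 mulr0.
have yp : 0 < `|y| ^+ 2 by rewrite exprn_gt0 // normr_gt0.
rewrite -(@ler_pXn2r _ 2%N) // ?nnegrE ?mulr_ge0 // real_normK ?num_real //.
rewrite exprMn -subr_ge0 -(pmulr_rge0 _ yp).
rewrite (_ : _ * _ = `| (`|y| ^+ 2) *: x - ip x y *: y | ^+ 2) ?sqr_ge0 //.
have ipB u v w := @ipBl _ _ _ u v w ipP; have ipZ a u v := @ipZl _ _ _ a u v ipP.
rewrite [RHS]ipn ipB !ipZ (ipC x (_ - _)) (ipC y (_ - _)) !ipB !ipZ -!ipn (ipC y x); ring.
Qed.

(** When the Bh_i sum to 1 the last term vanishes, and the extrapolated value is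
the most recent one plus a combination of increments. *)
Lemma abel_summation (R : realType) (E : lmodType R) (Bh : nat -> R) (f : nat -> E)
    (k : nat) :
  \sum_(1 <= i < k.+2) Bh i *: f i
  = f 1%N + \sum_(1 <= i < k.+1) bhat Bh i *: (f i - f i.+1)
      + bhat Bh k.+1 *: f k.+1.
Proof.
elim: k => [|k IH].
  by rewrite big_nat1 big_nil /bhat big_nat1 addr0 scalerBl scale1r addrC subrK.
rewrite big_nat_recr //= IH [in RHS]big_nat_recr //= -!addrA; congr (_ + (_ + _)).
have -> : bhat Bh k.+2 = bhat Bh k.+1 + Bh k.+2.
  by rewrite /bhat big_nat_recr //= addrAC.
by move: (bhat Bh k.+1) => b; rewrite scalerBr scalerDl addrA subrK.
Qed.

Lemma triangle_exchange (R : comNzRingType) (k : nat) (c d : nat -> R) :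
  \sum_(0 <= i < k) c i * \sum_(1 <= j < i.+1) d j
  = \sum_(1 <= j < k) (\sum_(j <= i < k) c i) * d j.
Proof.
elim: k => [|k IH]; first by rewrite !big_geq.
rewrite big_nat_recr //= IH; case: k {IH} => [|k]; first by rewrite !big_geq // mulr0 addr0.
rewrite [in RHS]big_nat_recr //= big_nat1 [in LHS](big_nat_recr k.+1) //= mulrDr addrA.
congr (_ + _); rewrite mulr_sumr -big_split /=.
apply: eq_big_nat => j /andP[j1 jk].
by rewrite [in RHS]big_nat_recr ?(ltnW jk) //= mulrDl.
Qed.

Lemma mulr_le_mean_sqr (R : realFieldType) (x y : R) : x * y <= (x ^+ 2 + y ^+ 2) / 2.
Proof. have := sqr_ge0 (x - y); lra. Qed.

Lemma mulr_bound (R : realFieldType) (x y a b : R) :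
  `|x| <= a -> `|y| <= b -> x * y <= a * b.
Proof.
move=> xa yb; apply: (le_trans (ler_norm _)); rewrite normrM.
by rewrite ler_pM.
Qed.

(** The left-hand side is what the proof of [nonlinear_estimate] produces. Its
middle sum has the coefficient i |mu_i| + sum_(j >= i) |mu_j| at D_i for
i >= 1, which is at most |mu_i| + sum_(j >= i) j |mu_j|; the other sums
occur in ctilde exactly. *)
Lemma ctilde_sum (R : realType) (k : nat) (mu Bh D : nat -> R) :
  (forall i, 0 <= D i) ->
  \sum_(0 <= i < k) `|mu i| * D i
  + \sum_(0 <= i < k) `|mu i| * (i%:R * D i + \sum_(1 <= j < i.+1) D j)
  + \sum_(1 <= j < k) \sum_(0 <= i < k) `|bhat Bh j| * `|mu i| * (D j + D i)
  <= \sum_(0 <= i < k) ctilde k mu Bh i * D i.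
Proof.
move=> D0; case: k => [|k]; first by rewrite !big_geq // !addr0.
set M := \sum_(0 <= i < k.+1) `|mu i|.
set N := \sum_(1 <= j < k.+1) `|bhat Bh j|.
have -> : \sum_(0 <= i < k.+1) ctilde k.+1 mu Bh i * D i
  = \sum_(1 <= i < k.+1) `|bhat Bh i| * M * D i
    + \sum_(0 <= i < k.+1) `|mu i| * N * D i + \sum_(0 <= i < k.+1) `|mu i| * D i
    + \sum_(1 <= i < k.+1) (`|mu i| + \sum_(i <= j < k.+1) j%:R * `|mu j|) * D i.
  have add0 (F : nat -> R) : \sum_(1 <= i < k.+1) F i
      = \sum_(0 <= i < k.+1) (i != 0%N)%:R * F i.
    rewrite [RHS]big_nat_recl //= mul0r add0r big_add1 /=.
    by apply: eq_bigr => i _; rewrite mul1r.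
  rewrite !add0 -!big_split /=; apply: eq_bigr => i _.
  by rewrite /ctilde -/M -/N; ring.
have -> : \sum_(1 <= j < k.+1) \sum_(0 <= i < k.+1) `|bhat Bh j| * `|mu i| * (D j + D i)
  = \sum_(1 <= i < k.+1) `|bhat Bh i| * M * D i
    + \sum_(0 <= i < k.+1) `|mu i| * N * D i.
  have -> : \sum_(0 <= i < k.+1) `|mu i| * N * D i
    = \sum_(1 <= j < k.+1) \sum_(0 <= i < k.+1) `|bhat Bh j| * `|mu i| * D i.
    rewrite exchange_big /=; apply: eq_bigr => i _.
    by rewrite mulrAC mulr_sumr; apply: eq_bigr => j _; ring.
  rewrite -big_split /=; apply: eq_bigr => j _.
  rewrite /M mulr_sumr mulr_suml -big_split /=; apply: eq_bigr => i _; ring.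
rewrite [leLHS]addrC -!addrA !lerD2l.
under [leLHS]eq_bigr do rewrite mulrDr.
rewrite big_split /= triangle_exchange big_nat_recl //= mul0r mulr0 add0r.
rewrite [X in X + _](_ : _ = \sum_(1 <= i < k.+1) `|mu i| * (i%:R * D i)); last first.
  by rewrite big_add1.
rewrite -big_split /=; rewrite !big_seq; apply: ler_sum => i.
rewrite mem_index_iota => /andP[i1 ik].
rewrite mulrA -mulrDl ler_wpM2r //.
rewrite !(big_ltn ik) -subr_ge0.
have -> : `|mu i| + (i%:R * `|mu i| + \sum_(i.+1 <= j < k.+1) j%:R * `|mu j|)
   - (`|mu i| * i%:R + (`|mu i| + \sum_(i.+1 <= j < k.+1) `|mu j|))
  = \sum_(i.+1 <= j < k.+1) (j%:R - 1) * `|mu j|.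
  under [RHS]eq_bigr do rewrite mulrBl mul1r.
  rewrite sumrB; ring.
rewrite big_seq; apply: sumr_ge0 => j; rewrite mem_index_iota => /andP[ij _].
by rewrite mulr_ge0 // subr_ge0 ler1n (leq_trans _ ij).
Qed.

Lemma norm_telescope (R : realType) (E : normedModType R) (v : nat -> E) (i : nat) :
  `|v 1%N - v i.+1| <= \sum_(1 <= j < i.+1) `|v j - v j.+1|.
Proof.
elim: i => [|i IH]; first by rewrite subrr normr0 big_geq.
rewrite big_nat_recr //=; apply: le_trans (lerD IH (lexx _)).
by apply: le_trans (ler_normD _ _); rewrite addrA subrK.
Qed.

(** Taylor expansion at v_{i+1} replaces F(v_i) - F(v_{i+1}) by
(f_{i+1}, d_i), where d_i = v_i - v_{i+1}. The discrepancy with (f_1, d_i) and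
the increments of f left by [abel_summation] are bounded through the
Lipschitz condition by products |d_j| |d_i|, hence by mean squares. *)
Lemma nonlinear_estimate (R : realType) (E : normedModType R) (ip : E -> E -> R)
    (v f : nat -> E) (F : nat -> R) (l : R) (k : nat) (mu Bh : nat -> R) :
  inner_product ip -> 0 <= l ->
  (forall i j, `|f i - f j| <= l * `|v i - v j|) ->
  (forall i j, `|F i - F j - ip (f j) (v i - v j)| <= l / 2 * `|v i - v j| ^+ 2) ->
  \sum_(1 <= i < k.+2) Bh i = 1 ->
  \sum_(0 <= i < k.+1) mu i * (F i - F i.+1)
  <= ip (\sum_(1 <= i < k.+2) Bh i *: f i)
        (\sum_(0 <= i < k.+1) mu i *: (v i - v i.+1))
     + l / 2 * \sum_(0 <= i < k.+1) ctilde k.+1 mu Bh i * `|v i - v i.+1| ^+ 2.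
Proof.
move=> ipP l0 flip Ftaylor Bh1.
pose d i := v i - v i.+1; pose D i := `|d i| ^+ 2.
have ipE : ip (\sum_(1 <= i < k.+2) Bh i *: f i)
    (\sum_(0 <= i < k.+1) mu i *: (v i - v i.+1))
  = \sum_(0 <= i < k.+1) mu i * ip (f 1%N) (d i)
    + \sum_(1 <= j < k.+1) \sum_(0 <= i < k.+1)
        bhat Bh j * (mu i * ip (f j - f j.+1) (d i)).
  rewrite abel_summation /bhat Bh1 subrr scale0r addr0 ipDl // ip_sumr //.
  congr (_ + _); rewrite ip_suml //; apply: eq_bigr => j _.
  by rewrite ip_sumr // mulr_sumr.
have l2 : 0 <= l / 2 by rewrite divr_ge0.
have b1 i : mu i * (F i - F i.+1) - mu i * ip (f 1%N) (d i)
    <= l / 2 * (`|mu i| * D i)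
       + l / 2 * (`|mu i| * (i%:R * D i + \sum_(1 <= j < i.+1) D j)).
  have -> : mu i * (F i - F i.+1) - mu i * ip (f 1%N) (d i)
     = mu i * (F i - F i.+1 - ip (f i.+1) (d i)) - mu i * ip (f 1%N - f i.+1) (d i).
    by rewrite ipBl //; ring.
  apply: lerD.
    apply: (@le_trans _ _ (`|mu i| * (l / 2 * D i))); last by rewrite mulrCA.
    exact: mulr_bound.
  rewrite -mulNr.
  apply: (@le_trans _ _ (`|mu i| * (l * (\sum_(1 <= j < i.+1) `|d j|) * `|d i|))).
    apply: mulr_bound; first by rewrite normrN.
    apply: (le_trans (cauchy_schwarz _ _ ipP)); rewrite ler_wpM2r //.
    by apply: (le_trans (flip _ _)); rewrite ler_wpM2l // norm_telescope.
  rewrite [leRHS]mulrCA ler_wpM2l // -!mulrA ler_wpM2l // mulr_suml.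
  rewrite [leRHS]mulrC.
  have -> : i%:R * D i + \sum_(1 <= j < i.+1) D j = \sum_(1 <= j < i.+1) (D j + D i).
    by rewrite big_split /= sumr_const_nat subn1 /= mulr_natl addrC.
  rewrite mulr_suml; apply: ler_sum => j _; exact: mulr_le_mean_sqr.
have b2 i j : - (bhat Bh j * (mu i * ip (f j - f j.+1) (d i)))
    <= l / 2 * (`|bhat Bh j| * `|mu i| * (D j + D i)).
  rewrite -mulNr mulrA.
  apply: (@le_trans _ _ (`|bhat Bh j| * `|mu i| * (l * `|d j| * `|d i|))).
    apply: mulr_bound; first by rewrite normrM normrN.
    apply: (le_trans (cauchy_schwarz _ _ ipP)); rewrite ler_wpM2r //.
  rewrite [leRHS]mulrCA ler_wpM2l ?mulr_ge0 // -!mulrA ler_wpM2l //.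
  by rewrite [leRHS]mulrC mulr_le_mean_sqr.
have := @ctilde_sum R k.+1 mu Bh D (fun i => sqr_ge0 _).
move/(ler_wpM2l l2); rewrite ipE -/D => H.
rewrite -lerBlDl; apply: le_trans H; rewrite !mulrDr !mulr_sumr.
rewrite opprD addrA -sumrB -big_split /=; apply: lerD.
  by apply: ler_sum => i _; exact: b1.
rewrite -sumrN; apply: ler_sum => j _.
by rewrite -sumrN mulr_sumr; apply: ler_sum => i _; exact: b2.
Qed.

(** * Absorbing the explicit error by interpolation *)

Lemma sqr_powR (R : realType) (x e : R) : 0 <= x -> (x ^+ 2) `^ e = (x `^ e) ^+ 2.
Proof. by move=> x0; rewrite -(powR_mulrn 2 x0) -(powR_mulrn 2 (powR_ge0 x e)) powRAC. Qed.

(** Weighted Young: with X = alpha / (tau eta) and Y = beta / (1 - eta),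
X^eta Y^(1-eta) m^(2 eta) l^(2 (1-eta)) <= (alpha/tau) m^2 + beta l^2, and the
bound on tau, raised to the power eta, says that C zeta^2 <= X^eta Y^(1-eta).
The case eta = 1 has no conjugate exponent and is direct. *)
Lemma young_interpolation (R : realType) (alpha beta C zeta eta tau dl m l : R) :
  0 < alpha -> 0 < beta -> 0 < zeta -> 0 < eta -> eta <= 1 ->
  0 <= dl -> 0 <= m -> 0 <= l ->
  dl <= zeta * m `^ eta * l `^ (1 - eta) ->
  0 < tau <= alpha * beta `^ ((1 - eta) / eta)
    / (C `^ (1 + (1 - eta) / eta) * eta
       * (1 - eta) `^ ((1 - eta) / eta) * zeta `^ (2 + 2 * ((1 - eta) / eta))) ->
  C * dl ^+ 2 <= alpha / tau * m ^+ 2 + beta * l ^+ 2.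
Proof.
move=> a0 b0 z0 e0 e1 dl0 m0 l0 dlE /andP[t0 tle].
have [a0' b0' z0' t0'] := And4 (ltW a0) (ltW b0) (ltW z0) (ltW t0).
have rhs0 : 0 <= alpha / tau * m ^+ 2 + beta * l ^+ 2.
  apply: addr_ge0; apply: mulr_ge0; rewrite ?sqr_ge0 //.
  by rewrite divr_ge0.
have [C0|C0] := leP C 0.
  by apply: le_trans rhs0; rewrite mulr_le0_ge0 ?sqr_ge0.
have dl2 : dl ^+ 2 <= zeta ^+ 2 * (m ^+ 2) `^ eta * (l ^+ 2) `^ (1 - eta).
  have -> : zeta ^+ 2 * (m ^+ 2) `^ eta * (l ^+ 2) `^ (1 - eta)
    = (zeta * m `^ eta * l `^ (1 - eta)) ^+ 2.
    by rewrite !exprMn !sqr_powR.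
  by rewrite ler_pXn2r // nnegrE !mulr_ge0 ?powR_ge0.
have C0' := ltW C0.
move: e1; rewrite le_eqVlt => /orP[/eqP eE|e1].
  move: tle dl2; rewrite eE subrr mul0r !powRr0 mulr0 !addr0 !mulr1 powRr1 //.
  rewrite powRr1 ?sqr_ge0 // (powR_mulrn 2) // => tle dl2.
  rewrite ler_wpDr ?mulr_ge0 ?sqr_ge0 //.
  apply: (le_trans (ler_wpM2l (ltW C0) dl2)); rewrite mulrA ler_wpM2r ?sqr_ge0 //.
  have cz : 0 < C * zeta ^+ 2 by rewrite mulr_gt0 ?exprn_gt0.
  by move: tle; rewrite !ler_pdivlMr // mulrC.
have e0' := ltW e0.
have f0 : 0 < 1 - eta by rewrite subr_gt0.
have f0' := ltW f0.
have [X XE] : exists X, X = alpha / tau / eta by exists (alpha / tau / eta).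
have [Y YE] : exists Y, Y = beta / (1 - eta) by exists (beta / (1 - eta)).
have X0 : 0 < X by rewrite XE !divr_gt0.
have Y0 : 0 < Y by rewrite YE divr_gt0.
have X0' := ltW X0; have Y0' := ltW Y0.
have key : C * zeta ^+ 2 <= X `^ eta * Y `^ (1 - eta).
  pose h := (1 - eta) / eta.
  have he : h * eta = 1 - eta by rewrite /h; field; rewrite gt_eqF.
  have h1e : (1 + h) * eta = 1 by rewrite mulrDl he; ring.
  have h2e : (2 + 2 * h) * eta = 2 by rewrite -[2 + _]mulr1; lra.
  have Xle : C `^ (1 + h) * (1 - eta) `^ h * zeta `^ (2 + 2 * h) / beta `^ h <= X.
    rewrite XE ler_pdivrMr ?powR_gt0 //.
    move: tle; rewrite -/h ler_pdivlMr; last by rewrite !mulr_gt0 ?powR_gt0.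
    move=> tle; have -> : alpha / tau / eta * beta `^ h = (alpha * beta `^ h) / (tau * eta).
      by field; rewrite !gt_eqF.
    rewrite ler_pdivlMr ?mulr_gt0 //; apply: le_trans tle.
    by rewrite le_eqVlt; apply/orP; left; apply/eqP; ring.
  have Xe : (C `^ (1 + h) * (1 - eta) `^ h * zeta `^ (2 + 2 * h) / beta `^ h) `^ eta
      <= X `^ eta.
    apply: (ge0_ler_powR e0' _ _ Xle); rewrite nnegrE // mulr_ge0 //.
      by rewrite !mulr_ge0 ?powR_ge0.
    by rewrite invr_ge0 powR_ge0.
  move: Xe; rewrite !powRM ?mulr_ge0 ?powR_ge0 ?invr_ge0 ?powR_ge0 //.
  rewrite -!powRrM h1e he h2e powRr1 // (powR_mulrn 2) //.
  rewrite -[(beta `^ h)^-1]powR_inv1 ?powR_ge0 // -!powRrM mulN1r mulrN he powRN => Xe.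
  rewrite YE powRM ?invr_ge0 // -[(1 - eta)^-1]powR_inv1 // -powRrM mulN1r powRN.
  have -> : C * zeta ^+ 2 = (C * (1 - eta) `^ (1 - eta) * zeta ^+ 2 / beta `^ (1 - eta))
      * (beta `^ (1 - eta) * ((1 - eta) `^ (1 - eta))^-1).
    by field; rewrite !gt_eqF ?powR_gt0.
  by rewrite ler_wpM2r // mulr_ge0 ?invr_ge0 ?powR_ge0.
apply: (le_trans (ler_wpM2l (ltW C0) dl2)).
apply: (@le_trans _ _ ((X * m ^+ 2) `^ eta * (Y * l ^+ 2) `^ (1 - eta))).
  rewrite !powRM ?sqr_ge0 //.
  rewrite [leRHS]mulrACA -(mulrA (zeta ^+ 2)) [leLHS]mulrA ler_wpM2r //.
  by rewrite !mulr_ge0 ?powR_ge0.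
have := @conjugate_powR R ((X * m ^+ 2) `^ eta) ((Y * l ^+ 2) `^ (1 - eta))
  eta^-1 (1 - eta)^-1.
rewrite !powR_ge0 !invr_gt0 !invrK e0 f0 addrCA subrr addr0.
move=> /(_ isT isT isT isT erefl) /le_trans; apply.
rewrite -!powRrM !mulfV ?gt_eqF // !powRr1; last 2 first.
- by rewrite mulr_ge0 ?sqr_ge0.
- by rewrite mulr_ge0 ?sqr_ge0.
by rewrite XE YE le_eqVlt; apply/orP; left; apply/eqP; field; rewrite !gt_eqF.
Qed.

(** * Energy dissipation *)

Lemma continuous_linear_le (R : realType) (U W : normedModType R) (f : {linear U -> W}) :
  continuous f -> exists M, forall x, `|f x| <= M * `|x|.
Proof.
move/linear_bounded_continuous/linear_boundedP => [M [_ H]].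
by exists (M + 1) => x; apply: H; rewrite ltrDl.
Qed.

(** The bilinear form of -M is symmetric, bounded and coercive, and h acts
continuously on V because the embedding of V into H is continuous. *)
Lemma opM_invM (R : realType) (D : domain R) (P : gradient_flow D) (h : gfH P) :
  opM P (invM (iHV' h)) = iHV' h.
Proof.
suff [u uE] : exists u, opM P u = iHV' h.
  by rewrite /invM pinvK //; apply/mem_set; exists u.
have [_ iVHc _] := iVHP P; have [K HK] := continuous_linear_le iVHc.
case: (@lax_milgram_sym R (gfV P) (fun x y => - opM P x y)
  (fun v => - ipH h (iVH P v)) (bndM P) (coerM P) (`|h| * K)).
- by move=> x y; rewrite opM_sym.
- by move=> k x y z; rewrite linearP /= [(_ + _) z]/(_ z + _ z) opprD mulrN.
- move=> k x y; rewrite linearP /=; have [ipC ipl _] := ipHP P.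
  by rewrite !(ipC h) ipl opprD mulrN.
- exact: coerM_gt0.
- by move=> x y; rewrite normrN; apply: opM_bounded.
- exact: opM_coercive.
- move=> x; rewrite normrN; apply: (le_trans (cauchy_schwarz _ _ (ipHP P))).
  by rewrite -mulrA ler_wpM2l.
by move=> u Hu; exists u; apply/funext => v; apply: oppr_inj; exact: Hu.
Qed.

Lemma opM_inj (R : realType) (D : domain R) (P : gradient_flow D) : injective (opM P).
Proof.
move=> x y xy; apply/eqP; rewrite -subr_eq0 -normr_eq0 -sqrf_eq0.
have d0 : opM P (x - y) = 0 by rewrite linearB xy subrr.
have := opM_coercive (x - y); rewrite d0 oppr0.
rewrite pmulr_rle0 ?coerM_gt0 // => h.
by rewrite eq_le h sqr_ge0.
Qed.

(** The pairing given by -M^{-1}; its norm is that of (-M)^{-1/2}. *)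
Definition dualip (R : realType) (D : domain R) (P : gradient_flow D) (x y : gfH P) : R :=
  - ipH x (iVH P (invM (iHV' y))).

(** Symmetry and positivity are visible in this form. *)
Lemma dualipE (R : realType) (D : domain R) (P : gradient_flow D) (x y : gfH P) :
  dualip x y = - opM P (invM (iHV' x)) (invM (iHV' y)).
Proof. by rewrite /dualip opM_invM. Qed.

Lemma dualipC (R : realType) (D : domain R) (P : gradient_flow D) (x y : gfH P) :
  dualip x y = dualip y x.
Proof. by rewrite !dualipE opM_sym. Qed.

Lemma dualip_ge0 (R : realType) (D : domain R) (P : gradient_flow D) (x : gfH P) :
  0 <= dualip x x.
Proof.
rewrite dualipE; apply: le_trans (opM_coercive _).
by rewrite mulr_ge0 ?sqr_ge0 ?(ltW (coerM_gt0 P)).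
Qed.

Lemma dualip_suml (R : realType) (D : domain R) (P : gradient_flow D) (I : Type)
    (r : seq I) (c : I -> R) (x : I -> gfH P) (z : gfH P) :
  dualip (\sum_(i <- r) c i *: x i) z = \sum_(i <- r) c i * dualip (x i) z.
Proof.
rewrite /dualip (ip_suml _ _ _ _ (ipHP P)) -sumrN.
by apply: eq_bigr => i _; rewrite mulrN.
Qed.

Lemma dualip_double_sum (R : realType) (D : domain R) (P : gradient_flow D)
    (n : nat) (s t : nat -> R) (w : nat -> gfH P) :
  \sum_(i < n) \sum_(j < n) s i * t j * dualip (w i) (w j)
  = dualip (\sum_(0 <= i < n) s i *: w i) (\sum_(0 <= i < n) t i *: w i).
Proof.
rewrite dualip_suml big_mkord; apply: eq_bigr => i _.
rewrite dualipC dualip_suml big_mkord mulr_sumr; apply: eq_bigr => j _.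
by rewrite mulrA dualipC.
Qed.

(** The pairing given by L; its seminorm is that of L^{1/2}. *)
Definition energyip (R : realType) (D : domain R) (P : gradient_flow D) (x y : gfS P) : R :=
  ipH (iSH x) (iVH P (opL P y)).

Lemma energyipC (R : realType) (D : domain R) (P : gradient_flow D) (x y : gfS P) :
  energyip x y = energyip y x.
Proof. by rewrite /energyip -opL_sym; have [ipC _ _] := ipHP P; rewrite ipC. Qed.

Lemma iSH_sum (R : realType) (D : domain R) (P : gradient_flow D) (I : Type)
    (r : seq I) (c : I -> R) (x : I -> gfS P) :
  iSH (\sum_(i <- r) c i *: x i) = \sum_(i <- r) c i *: iSH (x i).
Proof.
by rewrite /iSH !linear_sum; apply: eq_bigr => i _; rewrite !linearZ.
Qed.

Lemma iSHB (R : realType) (D : domain R) (P : gradient_flow D) (x y : gfS P) :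
  iSH (x - y) = iSH x - iSH y.
Proof. by rewrite /iSH !linearB. Qed.

Lemma energyip_double_sum (R : realType) (D : domain R) (P : gradient_flow D)
    (n : nat) (s t : nat -> R) (w : nat -> gfS P) :
  \sum_(i < n) \sum_(j < n) s i * t j * energyip (w i) (w j)
  = energyip (\sum_(0 <= i < n) s i *: w i) (\sum_(0 <= i < n) t i *: w i).
Proof.
rewrite /energyip iSH_sum (ip_suml _ _ _ _ (ipHP P)) big_mkord.
apply: eq_bigr => i _; rewrite !linear_sum big_mkord.
under [in RHS]eq_bigr do rewrite !linearZ.
rewrite (ip_sumr _ _ _ _ (ipHP P)) mulr_sumr; apply: eq_bigr => j _.
by rewrite mulrA.
Qed.

Lemma sum_nu_of (R : realType) (E : lmodType R) (m : nat) (mu : nat -> R) (v : nat -> E) :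
  \sum_(0 <= i < m.+1) mu i *: (v i - v i.+1)
  = \sum_(0 <= i < m.+2) nu_of m.+1 mu i *: v i.
Proof.
under eq_bigr do rewrite scalerBr.
rewrite sumrB big_nat_recl //= [X in _ - X]big_nat_recr //=.
rewrite [RHS]big_nat_recl //= [in RHS]big_nat_recr //= /nu_of /= eqxx scaleNr.
rewrite opprD -!addrA; congr (_ + _); rewrite !addrA; congr (_ - _).
rewrite -sumrB; apply: eq_big_nat => i /andP[_ im].
by rewrite eqSS ltn_eqF // -scalerBl.
Qed.

Lemma nu_of_suma (R : realType) (m : nat) (A : nat -> R) (i : nat) :
  \sum_(0 <= i < m.+2) A i = 0 -> (i < m.+2)%N -> nu_of m.+1 (suma A) i = A i.
Proof.
move=> A0 im; rewrite /nu_of /suma; case: eqP => [->|/eqP i0].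
  by rewrite big_nat1.
case: eqP => [->|_] /=.
  by apply/eqP; rewrite eq_sym -addr_eq0 addrC -big_nat_recr //= A0.
by case: i i0 {im} => // i _ /=; rewrite big_nat_recr //= [LHS]addrC addKr.
Qed.

(** Indexing backwards from time n makes the energy at time n the one at time
n + 1 with v and e shifted by one. *)
Lemma modified_energyE (R : realType) (D : domain R) (P : gradient_flow D) (m : nat)
    (mu Bh : nat -> R) (Ga : 'M[R]_m) (GB : 'M[R]_m.+1) (tau : R)
    (u : nat -> gfS P) (n : nat) :
  let v i := u (n - i)%N in
  let e i := iSH (v i - v i.+1) in
  modified_energy (k := m.+1) mu Bh Ga GB tau u n
  = tau^-1 * (\sum_(i < m) \sum_(j < m) Ga i j * dualip (e i) (e j))
    + \sum_(i < m.+1) \sum_(j < m.+1) GB i j * energyip (v i) (v j)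
    + \sum_(0 <= i < m.+1) mu i * energyF (v i)
    + lipf P / 2 * \sum_(0 <= i < m) chat m.+1 mu Bh i.+1 * `|e i| ^+ 2.
Proof.
move=> v e; rewrite /modified_energy.
have duE i : u (n - i)%N - u (n - i).-1 = v i - v i.+1 by rewrite /v subnS.
congr (_ + _ + _ + _ * _).
  rewrite mulNr -mulrN; congr (_ * _); rewrite -sumrN; apply: eq_bigr => i _.
  rewrite -sumrN; apply: eq_bigr => j _.
  by rewrite !duE /dualip mulrN.
by rewrite big_add1 /=; apply: eq_bigr => i _; rewrite subSS duE.
Qed.

Lemma chat_recl (R : realType) (k : nat) (mu Bh : nat -> R) (i : nat) :
  (i < k)%N -> chat k mu Bh i = ctilde k mu Bh i + chat k mu Bh i.+1.
Proof. by move=> ik; rewrite /chat big_ltn. Qed.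

(** Each c-hat weight exceeds the next by ctilde, so advancing the c-hat sum by
one step releases the ctilde sum and leaves only the newest increment. *)
Lemma chat_telescope (R : realType) (m : nat) (mu Bh D : nat -> R) :
  \sum_(0 <= i < m) chat m.+1 mu Bh i.+1 * D i
    + \sum_(0 <= i < m.+1) ctilde m.+1 mu Bh i * D i
  = chat m.+1 mu Bh 0 * D 0%N + \sum_(0 <= i < m) chat m.+1 mu Bh i.+1 * D i.+1.
Proof.
have chat0 : chat m.+1 mu Bh m.+1 = 0 by rewrite /chat big_geq.
transitivity (\sum_(0 <= i < m.+1) chat m.+1 mu Bh i * D i); last first.
  by rewrite big_nat_recl.
transitivity (\sum_(0 <= i < m.+1) chat m.+1 mu Bh i.+1 * D i
    + \sum_(0 <= i < m.+1) ctilde m.+1 mu Bh i * D i).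
  by rewrite [in RHS]big_nat_recr //= chat0 mul0r addr0.
rewrite -big_split /=; apply: eq_big_nat => i /andP[_ im].
by rewrite (chat_recl mu Bh im) [RHS]mulrDl addrC.
Qed.

(** The two matrix inequalities, contracted with the Gram matrices of the
increments for -M^{-1} and of the values for L. *)
Lemma linear_part_dissipation (R : realType) (D : domain R) (P : gradient_flow D)
    (m : nat) (A B mu : nat -> R) (alpha beta : R) (Ga : 'M[R]_m) (GB : 'M[R]_m.+1)
    (v : nat -> gfS P) :
  let e i := iSH (v i - v i.+1) in
  pdc (k := m.+1) A B mu alpha beta Ga GB ->
  alpha * dualip (e 0%N) (e 0%N)
  <= dualip (\sum_(0 <= i < m.+1) mu i *: e i) (\sum_(0 <= i < m.+1) suma A i *: e i)
     - \sum_(i < m) \sum_(j < m) Ga i j * dualip (e i) (e j)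
     + \sum_(i < m) \sum_(j < m) Ga i j * dualip (e i.+1) (e j.+1) /\
  beta * energyip (v 0%N - v 1%N) (v 0%N - v 1%N)
  <= energyip (\sum_(0 <= i < m.+2) nu_of m.+1 mu i *: v i)
       (\sum_(0 <= i < m.+2) B i *: v i)
     - \sum_(i < m.+1) \sum_(j < m.+1) GB i j * energyip (v i) (v j)
     + \sum_(i < m.+1) \sum_(j < m.+1) GB i j * energyip (v i.+1) (v j.+1).
Proof.
move=> e [Ha HB]; split.
  rewrite -dualip_double_sum.
  rewrite -(@Umx_contraction _ m mu (suma A) Ga (fun i j => dualip (e i) (e j))); last first.
    by move=> i j; rewrite dualipC.
  have := @mx_contraction_le _ _ (Umx mu (suma A) Ga) alpha (fun i => (i == ord0)%:R)
    (fun i j => dualip (e i) (e j)).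
  move=> /(_ _ _ _)/wrap[x|i j||].
  - by rewrite sum_pick.
  - by rewrite dualipC.
  - apply: (@psdform_of_sum _ _ (fun i j => dualip (e i) (e j))) => c.
    by rewrite dualip_double_sum dualip_ge0.
  under eq_bigr do under eq_bigr do rewrite -mulrA.
  under eq_bigr do rewrite -mulr_sumr sum_pick.
  by rewrite sum_pick.
rewrite -energyip_double_sum.
rewrite -(@Umx_contraction _ m.+1 (nu_of m.+1 mu) B GB
  (fun i j => energyip (v i) (v j))); last first.
  by move=> i j; rewrite energyipC.
have := @mx_contraction_le _ _ (Umx (nu_of m.+1 mu) B GB) beta
  (fun i => (i == ord0)%:R - (i == inord 1)%:R) (fun i j => energyip (v i) (v j)).
move=> /(_ _ _ _)/wrap[x|i j||].
- by rewrite sum_diff01.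
- by rewrite energyipC.
- apply: (@psdform_of_sum _ _ (fun i j => energyip (v i) (v j))) => c.
  by rewrite energyip_double_sum /energyip -opL_sym opL_ge0.
under eq_bigr do under eq_bigr do rewrite -mulrA.
under eq_bigr do rewrite -mulr_sumr sum_diff01.
rewrite sum_diff01 inordK // => H; apply: le_trans H.
have ipB (x y z : gfH P) := @ipBl _ _ _ x y z (ipHP P).
rewrite le_eqVlt; apply/orP; left; apply/eqP; congr (_ * _).
have eB (x y z : gfS P) : energyip (x - y) z = energyip x z - energyip y z.
  by rewrite /energyip iSHB ipB.
by rewrite eB !(energyipC _ (_ - _)) !eB (energyipC (v 0%N) (v 1%N)).
Qed.

(** Applying M^{-1} to the scheme and pairing it with the multiplier combination
of increments, which by summation by parts is the nu-combination of values. *)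
Lemma scheme_tested (R : realType) (D : domain R) (P : gradient_flow D)
    (m : nat) (A B Bh mu : nat -> R) (tau : R) (v : nat -> gfS P) :
  let e i := iSH (v i - v i.+1) in
  0 < tau -> \sum_(0 <= i < m.+2) A i = 0 ->
  iHV' (iSH (\sum_(0 <= i < m.+2) A i *: v i))
    = tau *: opM P (\sum_(0 <= i < m.+2) B i *: opL P (v i)
                    + \sum_(1 <= i < m.+2) Bh i *: nonlin (v i)) ->
  tau^-1 * dualip (\sum_(0 <= i < m.+1) mu i *: e i)
                  (\sum_(0 <= i < m.+1) suma A i *: e i)
    + energyip (\sum_(0 <= i < m.+2) nu_of m.+1 mu i *: v i)
               (\sum_(0 <= i < m.+2) B i *: v i)
  = - ipH (\sum_(1 <= i < m.+2) Bh i *: iVH P (nonlin (v i)))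
          (\sum_(0 <= i < m.+1) mu i *: e i).
Proof.
move=> e t0 A0 sch.
have [ipC _ _] := ipHP P.
have yE : \sum_(0 <= i < m.+1) mu i *: e i
    = iSH (\sum_(0 <= i < m.+2) nu_of m.+1 mu i *: v i).
  by rewrite -sum_nu_of iSH_sum.
have xE : \sum_(0 <= i < m.+1) suma A i *: e i = iSH (\sum_(0 <= i < m.+2) A i *: v i).
  rewrite -iSH_sum sum_nu_of; congr iSH; apply: eq_big_nat => i /andP[_ im].
  by rewrite nu_of_suma.
set w := _ + _ in sch.
have xw : invM (iHV' (iSH (\sum_(0 <= i < m.+2) A i *: v i))) = tau *: w.
  by apply: opM_inj; rewrite opM_invM sch linearZ.
rewrite xE /dualip xw linearZ /= /energyip yE.
set y := iSH _.
have ipZr a x z : ipH (g:=P) z (a *: x) = a * ipH z x.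
  by rewrite ipC (ipZl _ _ _ (ipHP P)) ipC.
rewrite ipZr mulrN mulKf ?gt_eqF // /w linearD /= ipC (ipDl _ _ _ (ipHP P)) !(ipC _ y).
have -> : opL P (\sum_(0 <= i < m.+2) B i *: v i) = \sum_(0 <= i < m.+2) B i *: opL P (v i).
  by rewrite linear_sum; apply: eq_bigr => i _; rewrite linearZ.
have -> : iVH P (\sum_(1 <= i < m.+2) Bh i *: nonlin (v i))
    = \sum_(1 <= i < m.+2) Bh i *: iVH P (nonlin (v i)).
  by rewrite linear_sum; apply: eq_bigr => i _; rewrite linearZ.
ring.
Qed.

(** Energy dissipation of any implicit-explicit multistep scheme that satisfies
the matrix inequalities. The proof adds up the bounds of the linear part, the
tested scheme, the nonlinear estimate and the interpolation estimate. *)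
Theorem pdc_energy_dissipation (R : realType) (m : nat) (A B Bh mu : nat -> R)
    (alpha beta : R) (Ga : 'M[R]_m) (GB : 'M[R]_m.+1) :
  0 < alpha -> 0 < beta ->
  \sum_(0 <= i < m.+2) A i = 0 -> \sum_(1 <= i < m.+2) Bh i = 1 ->
  pdc (k := m.+1) A B mu alpha beta Ga GB ->
  energy_dissipation (k := m.+1) A B Bh mu alpha beta Ga GB.
Proof.
have arith (p b l c d s X QA QA' Y QB QB' Z F F' CT C C' D0 r : R) :
    r * d <= p * (X - QA + QA') -> b * s <= Y - QB + QB' -> p * X + Y = - Z ->
    F - F' <= Z + l / 2 * CT -> C + CT = c * D0 + C' ->
    l * c / 2 * D0 <= r * d + b * s ->
    p * QA + QB + F + l / 2 * C <= p * QA' + QB' + F' + l / 2 * C'.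
  move=> h1 h2 h3 h4 h5 h6.
  have h7 : l / 2 * C + l / 2 * CT = l * c / 2 * D0 + l / 2 * C'.
    by rewrite -mulrDr h5; ring.
  rewrite mulrDr mulrBr in h1; lra.
move=> a0 b0 A0 Bh1 H d _ P T N u _ _ tau sch taule n nle.
have /andP[t0 _] := taule.
pose v i := u (n.+1 - i)%N.
pose e i := iSH (v i - v i.+1).
have [Ha HB] := linear_part_dissipation v H.
have tested := scheme_tested mu t0 A0 (sch n nle).
have nonlin_le : \sum_(0 <= i < m.+1) mu i * (energyF (v i) - energyF (v i.+1))
    <= ipH (\sum_(1 <= i < m.+2) Bh i *: iVH P (nonlin (v i)))
           (\sum_(0 <= i < m.+1) mu i *: e i)
       + lipf P / 2 * \sum_(0 <= i < m.+1) ctilde m.+1 mu Bh i * `|e i| ^+ 2.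
  rewrite /e; under [X in ipH _ X]eq_bigr do rewrite iSHB.
  under [X in _ + _ * X]eq_bigr do rewrite iSHB.
  apply: (@nonlinear_estimate R _ _ (fun i => iSH (v i))
    (fun i => iVH P (nonlin (v i))) (fun i => energyF (v i))) => //.
  - exact: ipHP.
  - exact: ltW (lipf_gt0 P).
  - by move=> i j; apply: nonlin_lipschitz.
  - by move=> i j; rewrite -iSHB; apply: energyF_taylor.
have tel := chat_telescope m mu Bh (fun i => `|e i| ^+ 2).
have young := @young_interpolation R alpha beta (lipf P * chat m.+1 mu Bh 0 / 2)
  (zeta P) (eta P) tau `|e 0%N| (normM (e 0%N)) (normL (v 0%N - v 1%N))
  a0 b0 (zeta_gt0 P) (eta_gt0 P) (eta_le1 P) (normr_ge0 _) (sqrtr_ge0 _)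
  (sqrtr_ge0 _) (interpolation _) taule.
have [ipC _ _] := ipHP P.
have ipNr x y : ipH (g:=P) x (- y) = - ipH x y.
  by rewrite ipC -scaleN1r (ipZl _ _ _ (ipHP P)) mulN1r ipC.
have normM2 : normM (e 0%N) ^+ 2 = dualip (e 0%N) (e 0%N).
  have E : ipH (e 0%N) (iVH P (- invM (iHV' (e 0%N)))) = dualip (e 0%N) (e 0%N).
    by rewrite linearN ipNr.
  by rewrite /normM E sqr_sqrtr // dualip_ge0.
have normL2 : normL (v 0%N - v 1%N) ^+ 2 = energyip (v 0%N - v 1%N) (v 0%N - v 1%N).
  by rewrite /normL sqr_sqrtr ?opL_ge0 // opL_sym.
rewrite normM2 normL2 in young.
have E1 : modified_energy (k := m.+1) mu Bh Ga GB tau u n.+1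
  = tau^-1 * (\sum_(i < m) \sum_(j < m) Ga i j * dualip (e i) (e j))
    + \sum_(i < m.+1) \sum_(j < m.+1) GB i j * energyip (v i) (v j)
    + \sum_(0 <= i < m.+1) mu i * energyF (v i)
    + lipf P / 2 * \sum_(0 <= i < m) chat m.+1 mu Bh i.+1 * `|e i| ^+ 2.
  exact: modified_energyE.
have E0 : modified_energy (k := m.+1) mu Bh Ga GB tau u n
  = tau^-1 * (\sum_(i < m) \sum_(j < m) Ga i j * dualip (e i.+1) (e j.+1))
    + \sum_(i < m.+1) \sum_(j < m.+1) GB i j * energyip (v i.+1) (v j.+1)
    + \sum_(0 <= i < m.+1) mu i * energyF (v i.+1)
    + lipf P / 2 * \sum_(0 <= i < m) chat m.+1 mu Bh i.+1 * `|e i.+1| ^+ 2.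
  exact: modified_energyE.
move: E1 E0 => /= -> ->.
have FE : \sum_(0 <= i < m.+1) mu i * (energyF (v i) - energyF (v i.+1))
  = \sum_(0 <= i < m.+1) mu i * energyF (v i)
    - \sum_(0 <= i < m.+1) mu i * energyF (v i.+1).
  by rewrite -sumrB; apply: eq_bigr => i _; rewrite mulrBr.
rewrite FE in nonlin_le.
have Ha' : alpha / tau * dualip (e 0%N) (e 0%N) <= tau^-1 *
   (dualip (\sum_(0 <= i < m.+1) mu i *: e i) (\sum_(0 <= i < m.+1) suma A i *: e i)
     - \sum_(i < m) \sum_(j < m) Ga i j * dualip (e i) (e j)
     + \sum_(i < m) \sum_(j < m) Ga i j * dualip (e i.+1) (e j.+1)).
  by rewrite mulrAC mulrC ler_wpM2l // invr_ge0 ltW.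
have le := arith _ _ _ _ _ _ _ _ _ _ _ _ _ _ _ _ _ _ _ _
  Ha' HB tested nonlin_le tel young.
exact: le.
Qed.

(** * Integer certificates *)

Lemma ofZD (R : realType) (x y : Z) : ofZ R (x + y) = ofZ R x + ofZ R y.
Proof. by rewrite /ofZ (rmorphD int_of_Z) rmorphD. Qed.

Lemma ofZM (R : realType) (x y : Z) : ofZ R (x * y) = ofZ R x * ofZ R y.
Proof. by rewrite /ofZ (rmorphM int_of_Z) rmorphM. Qed.

Lemma ofZN (R : realType) (x : Z) : ofZ R (- x) = - ofZ R x.
Proof. by rewrite /ofZ (rmorphN int_of_Z) rmorphN. Qed.

Lemma ofZB (R : realType) (x y : Z) : ofZ R (x - y) = ofZ R x - ofZ R y.
Proof. by rewrite -ofZN -ofZD. Qed.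

Lemma ofZ_ge0 (R : realType) (x : Z) : Z.leb Z0 x -> 0 <= ofZ R x.
Proof. by case: x. Qed.

Lemma ofZ_gt0 (R : realType) (x : Z) : Z.ltb Z0 x -> 0 < ofZ R x.
Proof.
case: x => // p _; rewrite /ofZ /= ltr0n; apply/ssrnat.ltP; exact: Pos2Nat.is_pos.
Qed.

Definition entry (rows : seq (seq Z)) (i j : nat) : Z := nth Z0 (nth [::] rows i) j.

Definition table (n : nat) (f : nat -> nat -> Z) : seq (seq Z) :=
  mkseq (fun i => mkseq (f i) n) n.

Lemma entry_table (n : nat) (f : nat -> nat -> Z) (i j : nat) :
  (i < n)%N -> (j < n)%N -> entry (table n f) i j = f i j.
Proof. by move=> ni nj; rewrite /entry /table !nth_mkseq. Qed.

(** Bareiss elimination: dividing by the previous pivot is exact and keeps the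
entries at the size of minors. Exactness is tested by [schur_check] rather
than proved. *)
Definition schur (n : nat) (prev : Z) (M : seq (seq Z)) : seq (seq Z) :=
  table n (fun i j => Z.div
    (Z.sub (Z.mul (entry M 0 0) (entry M i.+1 j.+1))
           (Z.mul (entry M i.+1 0) (entry M 0 j.+1))) prev).

Definition schur_check (n : nat) (prev : Z) (M S : seq (seq Z)) : bool :=
  all (fun i => Z.eqb (entry M i.+1 0) (entry M 0 i.+1) &&
    all (fun j => Z.eqb (Z.mul prev (entry S i j))
            (Z.sub (Z.mul (entry M 0 0) (entry M i.+1 j.+1))
                   (Z.mul (entry M i.+1 0) (entry M 0 j.+1)))) (iota 0 n))
    (iota 0 n).

(** The last pivot may be 0: the form of U_B vanishes on constant vectors. *)
Fixpoint psd_check (n : nat) (prev : Z) (M : seq (seq Z)) : bool :=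
  match n with
  | 0 => true
  | 1 => Z.leb Z0 (entry M 0 0)
  | n'.+1 =>
    let S := schur n' prev M in
    [&& Z.ltb Z0 (entry M 0 0), schur_check n' prev M S
      & psd_check n' (entry M 0 0) S]
  end.

(** With pivot d, first row (d, r) and next table S, d times the form is
(d x_0 + r.x)^2 plus prev times the form of S. *)
Lemma psd_check_sound (R : realType) (n : nat) (prev : Z) (M : seq (seq Z)) (x : nat -> R) :
  Z.ltb Z0 prev -> psd_check n prev M ->
  0 <= \sum_(i < n) \sum_(j < n) ofZ R (entry M i j) * (x i * x j).
Proof.
elim: n prev M x => [|[|n] IH] prev M x prev0; first by rewrite big_ord0.
  by rewrite /= !big_ord1 -expr2 => /(ofZ_ge0 R) h; rewrite mulr_ge0 ?sqr_ge0.
set n' := n.+1; rewrite [psd_check _ _ _]/= -/n'.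
set S := schur n' prev M => /and3P[d0 /seq.allP ok Sok].
have {}ok i j : (i < n')%N -> (j < n')%N ->
    ofZ R (entry M i.+1 0) = ofZ R (entry M 0 i.+1) /\
    ofZ R prev * ofZ R (entry S i j) = ofZ R (entry M 0 0) * ofZ R (entry M i.+1 j.+1)
      - ofZ R (entry M i.+1 0) * ofZ R (entry M 0 j.+1).
  move=> ni nj; have iI : i \in iota 0 n' by rewrite mem_iota.
  have jI : j \in iota 0 n' by rewrite mem_iota.
  have /andP[/Z.eqb_eq -> /seq.allP okj] := ok i iI.
  have /Z.eqb_eq e := okj j jI.
  by split=> //; rewrite -!ofZM e ofZB.
have := IH _ S (fun i => x i.+1) d0 Sok.
have {}d0 := ofZ_gt0 R d0; have {}prev0 := ofZ_gt0 R prev0.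
move=> /(mulr_ge0 (ltW prev0)) Q.
rewrite -(pmulr_rge0 _ d0).
pose L := \sum_(j < n') ofZ R (entry M 0 j.+1) * x j.+1.
rewrite (_ : _ * _ = (ofZ R (entry M 0 0) * x 0%N + L) ^+ 2
    + ofZ R prev * \sum_(i < n') \sum_(j < n') ofZ R (entry S i j) * (x i.+1 * x j.+1)).
  by rewrite addr_ge0 ?sqr_ge0.
have -> : ofZ R prev * (\sum_(i < n') \sum_(j < n') ofZ R (entry S i j) * (x i.+1 * x j.+1))
  = ofZ R (entry M 0 0) * (\sum_(i < n') \sum_(j < n')
      ofZ R (entry M i.+1 j.+1) * (x i.+1 * x j.+1)) - L ^+ 2.
  rewrite expr2 /L mulr_suml !mulr_sumr -sumrB; apply: eq_bigr => i _.
  rewrite !mulr_sumr -sumrB; apply: eq_bigr => j _.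
  have [h1 h2] := ok i j (ltn_ord i) (ltn_ord j).
  by rewrite mulrA h2 h1; ring.
rewrite big_ord_recl big_ord_recl /=.
have -> : \sum_(i < n') ofZ R (entry M 0 (bump 0 i)) * (x 0%N * x (bump 0 i)) = x 0%N * L.
  by rewrite /L mulr_sumr; apply: eq_bigr => i _; rewrite /bump leq0n add1n; ring.
have -> : \sum_(i < n') \sum_(j < n'.+1)
      ofZ R (entry M (bump 0 i) j) * (x (bump 0 i) * x j)
  = x 0%N * L + \sum_(i < n') \sum_(j < n')
      ofZ R (entry M i.+1 j.+1) * (x i.+1 * x j.+1).
  rewrite /L mulr_sumr -big_split /=; apply: eq_bigr => i _.
  have [h1 _] := ok i i (ltn_ord i) (ltn_ord i).
  rewrite big_ord_recl /= /bump leq0n add1n h1; congr (_ + _).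
  by ring.
by ring.
Qed.

Lemma psd_of_check (R : realType) (n : nat) (c : R) (f : nat -> nat -> Z) (M : 'M[R]_n)
    (x : 'cV[R]_n) :
  0 < c -> (forall i j : 'I_n, ofZ R (f i j) = c * M i j) ->
  psd_check n (Zpos 1) (table n f) -> 0 <= (x^T *m M *m x) 0 0.
Proof.
move=> c0 fM chk; rewrite mx_quadE -(pmulr_rge0 _ c0).
case: n M x fM chk => [|n] M x fM chk; first by rewrite big_ord0 mulr0.
have := psd_check_sound (fun i => x (inord i) 0) (isT : Z.ltb Z0 (Zpos 1)) chk.
congr (0 <= _); rewrite mulr_sumr; apply: eq_bigr => i _; rewrite mulr_sumr.
apply: eq_bigr => j _; rewrite entry_table ?ltn_ord // fM !inord_val.
by rewrite -mulrA.
Qed.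

Lemma block_ulE (R : pzRingType) (m : nat) (G : 'M[R]_m) (g : nat -> nat -> R) (i j : 'I_(m + 1)) :
  (forall i j : 'I_m, G i j = g i j) ->
  (forall i j, (m <= i)%N || (m <= j)%N -> g i j = 0) ->
  block_mx G 0 0 (0 : 'M[R]_1) i j = g i j.
Proof.
move=> Gg g0; case: (split_ordP i) => i' ->; case: (split_ordP j) => j' ->.
- by rewrite block_mxEul Gg.
- by rewrite block_mxEur mxE g0 //= leq_addr orbT.
- by rewrite block_mxEdl mxE g0 //= leq_addr.
- by rewrite block_mxEdr mxE g0 //= leq_addr.
Qed.

Lemma block_drE (R : pzRingType) (m : nat) (G : 'M[R]_m) (g : nat -> nat -> R) (i j : 'I_(1 + m)) :
  (forall i j : 'I_m, G i j = g i.+1 j.+1) ->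
  (forall i j, (i == 0%N) || (j == 0%N) -> g i j = 0) ->
  block_mx (0 : 'M[R]_1) 0 0 G i j = g i j.
Proof.
move=> Gg g0; case: (split_ordP i) => i' ->; case: (split_ordP j) => j' ->.
- by rewrite block_mxEul mxE g0 //= ord1.
- by rewrite block_mxEur mxE g0 //= ord1.
- by rewrite block_mxEdl mxE g0 //= (ord1 j').
- by rewrite block_mxEdr Gg.
Qed.

(** The entries of diag(0, G). Those of diag(G, 0) are given by [entry] itself,
which is 0 outside the table. *)
Definition shifted (rows : seq (seq Z)) (i j : nat) : Z :=
  match i, j with i'.+1, j'.+1 => entry rows i' j' | _, _ => Z0 end.

Lemma UmxE (R : realType) (m : nat) (s t : nat -> R) (c : R) (rows : seq (seq Z)) (i j : 'I_m.+1) :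
  (forall i j, (m <= i)%N || (m <= j)%N -> entry rows i j = Z0) ->
  Umx s t (c *: mx_of_Z R m rows) i j
  = 2^-1 * (s i * t j + t i * s j) - c * ofZ R (entry rows i j)
    + c * ofZ R (shifted rows i j).
Proof.
move=> rows0; rewrite /Umx mxE; congr (_ + _); last first.
  rewrite (@block_drE _ _ _ (fun i j => c * ofZ R (shifted rows i j))) //=.
    by move=> a b; rewrite !mxE.
  by move=> [|a] [|b] //= _; rewrite mulr0.
rewrite mxE; congr (_ + _); first by rewrite !mxE !big_ord1 !mxE.
rewrite mxE castmxE (@block_ulE _ _ _ (fun i j => c * ofZ R (entry rows i j))) //=.
  by move=> a b; rewrite !mxE.
by move=> a b ab; rewrite rows0 // mulr0.
Qed.

Definition fits (m : nat) (rows : seq (seq Z)) : bool :=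
  (size rows <= m)%N && all (fun r : seq Z => (size r <= m)%N) rows.

Lemma entry_out (m : nat) (rows : seq (seq Z)) (i j : nat) :
  fits m rows -> (m <= i)%N || (m <= j)%N -> entry rows i j = Z0.
Proof.
case/andP=> sr /seq.allP ar ij; rewrite /entry.
have [ri|ri] := leqP (size rows) i; first by rewrite (nth_default [::]) // nth_nil.
apply: nth_default; move: ij; rewrite leqNgt (leq_trans ri sr) /=.
by apply: leq_trans; apply: ar; exact: mem_nth.
Qed.

Lemma mx_quad_minus_square (R : realFieldType) (n : nat) (U : 'M[R]_n) (gamma : R)
    (l : 'I_n -> R) (x : 'cV[R]_n) :
  (x^T *m (U - \matrix_(i, j) (gamma * (l i * l j))) *m x) 0 0
  = (x^T *m U *m x) 0 0 - gamma * (\sum_i l i * x i 0) ^+ 2.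
Proof.
rewrite !mx_quadE expr2 mulr_suml mulr_sumr -sumrB; apply: eq_bigr => i _.
rewrite !mulr_sumr -sumrB; apply: eq_bigr => j _; rewrite !mxE; ring.
Qed.

(** The integer multiple of U - gamma l l^T that remains after clearing
denominators. *)
Definition Umx_table (p q r : Z) (S T l : seq Z) (rows : seq (seq Z)) (i j : nat) : Z :=
  Z.sub (Z.add (Z.sub
    (Z.mul p (Z.add (Z.mul (nth Z0 S i) (nth Z0 T j)) (Z.mul (nth Z0 T i) (nth Z0 S j))))
    (Z.mul q (entry rows i j))) (Z.mul q (shifted rows i j)))
    (Z.mul r (Z.mul (nth Z0 l i) (nth Z0 l j))).

(** The scalars s0, t0, g0 carry the denominators of s, t and G, and c clears
them. *)
Lemma Umx_psd (R : realType) (m : nat) (s t : nat -> R) (S T l : seq Z)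
    (rows : seq (seq Z)) (p q r : Z) (c s0 t0 g0 gamma : R) (x : 'cV[R]_m.+1) :
  0 < c -> c * (s0 * t0 / 2) = ofZ R p -> c * g0 = ofZ R q -> c * gamma = ofZ R r ->
  (forall i : nat, (i < m.+1)%N -> s i = s0 * ofZ R (nth Z0 S i)) ->
  (forall i : nat, (i < m.+1)%N -> t i = t0 * ofZ R (nth Z0 T i)) ->
  fits m rows -> psd_check m.+1 (Zpos 1) (table m.+1 (Umx_table p q r S T l rows)) ->
  gamma * (\sum_(i < m.+1) ofZ R (nth Z0 l i) * x i 0) ^+ 2
    <= (x^T *m Umx s t (g0 *: mx_of_Z R m rows) *m x) 0 0.
Proof.
move=> c0 cp cq cr sE tE rm chk; rewrite -subr_ge0 -mx_quad_minus_square.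
apply: psd_of_check c0 _ chk => i j.
rewrite mxE UmxE; last by move=> a b; apply: entry_out.
rewrite !mxE /Umx_table !(ofZB, ofZD, ofZM) -cp -cq -cr !sE ?ltn_ord // !tE ?ltn_ord //.
by field.
Qed.

Definition symmetric_rows (n : nat) (rows : seq (seq Z)) : bool :=
  all (fun i => all (fun j => Z.eqb (entry rows i j) (entry rows j i)) (iota 0 n)) (iota 0 n).

(** Positive definiteness with a margin: the integer matrix minus the identity
is already positive semidefinite. *)
Lemma posdefmx_of_check (R : realType) (n : nat) (rows : seq (seq Z)) (g0 : R) :
  0 < g0 -> symmetric_rows n rows ->
  psd_check n (Zpos 1)
    (table n (fun i j => Z.sub (entry rows i j) (if i == j then Zpos 1 else Z0))) ->
  posdefmx (g0 *: mx_of_Z R n rows).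
Proof.
move=> g00 /seq.allP sym chk; split.
  apply/matrixP => i j; rewrite !mxE; congr (_ * ofZ R _).
  have iI : val i \in iota 0 n by rewrite mem_iota ltn_ord.
  have jI : val j \in iota 0 n by rewrite mem_iota ltn_ord.
  by have /seq.allP/(_ _ iI)/Z.eqb_eq := sym _ jI.
move=> x x0.
have := @psd_of_check R n 1 _ (mx_of_Z R n rows - 1%:M) x ltr01 _ chk.
rewrite mulmxBr mulmxBl mulmx1 => /(_ _)/wrap[i j|].
  rewrite ofZB mul1r !mxE; congr (_ - _).
  by rewrite (inj_eq val_inj); case: eqP.
rewrite mxE [X in _ + X]mxE subr_ge0 => le.
rewrite -scalemxAr -scalemxAl mxE mulr_gt0 //; apply: lt_le_trans le.
have [i xi] : exists i, x i 0 != 0.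
  apply/existsP; apply: contraNT x0; rewrite negb_exists => /forallP x0.
  by apply/eqP/matrixP => i j; rewrite ord1 mxE; apply/eqP; move: (x0 i); rewrite negbK.
rewrite mxE (bigD1 i) //= mxE ltr_pwDl //.
  by rewrite -expr2 lt_def sqr_ge0 sqrf_eq0 xi.
by apply: sumr_ge0 => j _; rewrite mxE -expr2 sqr_ge0.
Qed.

(** Coefficients are listed from the lowest degree upwards, unlike those of
[genpoly]. *)
Definition polyZ (R : realType) (s : seq Z) : {poly R} := Poly (map (ofZ R) s).

Fixpoint addZs (s t : seq Z) : seq Z :=
  match s, t with
  | x :: s', y :: t' => Z.add x y :: addZs s' t'
  | [::], _ => t
  | _, [::] => s
  end.

Fixpoint mulZs (s t : seq Z) : seq Z :=
  if s is x :: s' then addZs (map (Z.mul x) t) (Z0 :: mulZs s' t) else [::].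

Lemma polyZ_cons (R : realType) (x : Z) (s : seq Z) :
  polyZ R (x :: s) = polyZ R s * 'X + (ofZ R x)%:P.
Proof. by rewrite /polyZ /= cons_poly_def. Qed.

Lemma polyZ_add (R : realType) (s t : seq Z) :
  polyZ R (addZs s t) = polyZ R s + polyZ R t.
Proof.
elim: s t => [|x s IH] [|y t] /=; rewrite ?add0r ?addr0 //.
by rewrite !polyZ_cons IH ofZD polyCD; ring.
Qed.

Lemma polyZ_scale (R : realType) (x : Z) (s : seq Z) :
  polyZ R (map (Z.mul x) s) = (ofZ R x)%:P * polyZ R s.
Proof.
elim: s => [|y s IH] /=; first by rewrite mulr0.
by rewrite !polyZ_cons IH ofZM polyCM; ring.
Qed.

Lemma polyZ_mul (R : realType) (s t : seq Z) :
  polyZ R (mulZs s t) = polyZ R s * polyZ R t.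
Proof.
elim: s => [|x s IH] /=; first by rewrite mul0r.
by rewrite polyZ_add polyZ_cons polyZ_scale IH polyZ_cons; ring.
Qed.

Lemma genpoly_polyZ (R : realType) (r : nat) (s : nat -> R) (c : R) (l : seq Z) :
  size l = r.+1 -> (forall i, (i < r.+1)%N -> s i = c * ofZ R (nth Z0 l i)) ->
  genpoly r s = c *: polyZ R (rev l).
Proof.
move=> sl sE; apply/polyP => j.
rewrite /genpoly big_nat_rev /= big_mkord coef_sum coefZ coef_Poly.
have [jr|jr] := ltnP j r.+1; last first.
  rewrite nth_default ?size_map ?size_rev ?sl // mulr0 big1 // => i _.
  rewrite coefZ coefXn subSS subKn ?(ltnW (ltn_ord i)) //; last by rewrite -ltnS.
  by rewrite gtn_eqF ?mulr0 // (leq_trans (ltn_ord i)).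
rewrite (nth_map Z0) ?size_rev ?sl // nth_rev ?sl // subSS -sE ?ltnS ?leq_subr //.
rewrite (bigD1 (Ordinal jr)) //= coefZ coefXn subSS subKn // eqxx mulr1.
rewrite big1 ?addr0 // => i ij.
have ir : (i <= r)%N by rewrite -ltnS.
rewrite coefZ coefXn subSS subKn //.
case: eqP => [ji|_]; last by rewrite mulr0.
by case/eqP: ij; apply: val_inj.
Qed.

(** The product of the Bezout identity is computed on lists, which keeps trailing
zeros: u s + v t is the constant c padded by zeros. *)
Lemma coprimep_polyZ (R : realType) (s t u v : seq Z) (c : Z) :
  Z.ltb Z0 c -> addZs (mulZs u s) (mulZs v t) = c :: nseq (size s + size u).-2 Z0 ->
  coprimep (polyZ R s) (polyZ R t).
Proof.
move=> c0 E; apply/Bezout_coprimepP; exists (polyZ R u, polyZ R v) => /=.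
rewrite -!polyZ_mul -polyZ_add E polyZ_cons.
rewrite (_ : polyZ R (nseq _ _) = 0) ?mul0r ?add0r.
  by rewrite polyC_eqp1 gt_eqF // ofZ_gt0.
by elim: (_.-2) => //= n IH; rewrite polyZ_cons IH mul0r add0r.
Qed.

(** * The eight-step scheme *)

Local Open Scope Z_scope.

(** Numerators over 4. *)
Definition mu8_num : seq Z := [:: 9; -13; 10; 0; -5; 6; -4; 1].

(** Numerators over 840. *)
Definition a8_num : seq Z := [:: 4369; -11899; 18509; -18647; 13553; -6691; 1877; -231].

(** Numerators over 4. *)
Definition nu8_num : seq Z := [:: 9; -22; 23; -10; -5; 11; -10; 5; -1].

Definition B8_num : seq Z := [:: 2; -2; 0; 2; -1; 0; 0; 0; 0].

(** The entry of index 0 comes from the empty sum: bhat_0 = -1 enters ctilde_0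
with the factor 0. *)
Definition bhat8_num : seq Z := [:: -1; 13; -43; 71; -70; 42; -14; 2].

(** The Bezout coefficients below come from the extended Euclidean algorithm over
the rationals, cleared of denominators. *)
Definition bezout_a8 : seq Z := [::
  -191249970202453599793; -1582613228861039577563; 375796362771883255797;
  -2393779893625335767312; -1363634837832817514880; 1438679615459413056998;
  -4308212826442148151897].

Definition bezout_mu8 : seq Z := [::
  -21908123850376855844471; -94239957198402158983476; 1532209354056511782092817;
  -2670850656341063805809776; 4227639036795225662502953;
  -3373426877192110863774396; 2091397982080638363959777].

Definition bezout_B8 : seq Z := [:: 388; -5046; 6512; -7471; 662; 10721; -17159; 11412].

Definition bezout_nu8 : seq Z := [:: -19; -95; -285; -684; -1908; 652; 150; -2536].

Local Close Scope Z_scope.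

Lemma mu8E (R : realType) (i : nat) :
  (i < 8)%N -> mu8 R i = 4^-1 * ofZ R (nth Z0 mu8_num i).
Proof. by do 8 (case: i => [_|i]; first by rewrite /mu8 /=; lra). Qed.

Lemma nu8E (R : realType) (i : nat) :
  (i < 9)%N -> nu_of 8 (@mu8 R) i = 4^-1 * ofZ R (nth Z0 nu8_num i).
Proof. by do 9 (case: i => [_|i]; first by rewrite /nu_of /mu8 /=; lra). Qed.

Lemma B8E (R : realType) (i : nat) :
  (i < 9)%N -> B8 R i = 1 * ofZ R (nth Z0 B8_num i).
Proof. by do 9 (case: i => [_|i]; first by rewrite /B8 /=; lra). Qed.

Lemma a8E (R : realType) (i : nat) :
  (i < 8)%N -> suma (@A8 R) i = 840^-1 * ofZ R (nth Z0 a8_num i).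
Proof.
by do 8 (case: i => [_|i]; first by rewrite /suma unlock /A8 /=; lra).
Qed.

Lemma coprime_a8_mu8 (R : realType) :
  coprimep (genpoly 7 (suma (@A8 R))) (genpoly 7 (@mu8 R)).
Proof.
rewrite (genpoly_polyZ _ (@a8E R)) // (genpoly_polyZ _ (@mu8E R)) //.
rewrite coprimepZl ?invr_eq0 ?pnatr_eq0 // coprimepZr ?invr_eq0 ?pnatr_eq0 //.
by apply: (@coprimep_polyZ R _ _ bezout_a8 bezout_mu8 22270619266389925707712); vm_compute.
Qed.

Lemma coprime_B8_nu8 (R : realType) :
  coprimep (genpoly 8 (@B8 R)) (genpoly 8 (nu_of 8 (@mu8 R))).
Proof.
rewrite (genpoly_polyZ _ (@B8E R)) // (genpoly_polyZ _ (@nu8E R)) //.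
rewrite coprimepZl ?oner_eq0 // coprimepZr ?invr_eq0 ?pnatr_eq0 //.
by apply: (@coprimep_polyZ R _ _ bezout_B8 bezout_nu8 19); vm_compute.
Qed.

Lemma posdef_Ga8 (R : realType) : posdefmx (Ga8 R).
Proof.
apply: posdefmx_of_check; [by rewrite invr_gt0 exprn_gt0|by vm_compute..].
Qed.

Lemma posdef_GB8 (R : realType) : posdefmx (GB8 R).
Proof.
apply: posdefmx_of_check; [by rewrite invr_gt0 exprn_gt0|by vm_compute..].
Qed.

(** The common denominators are 840000 for U_a and 5300000 for U_B; the weights
are 840000 / (2 * 4 * 840) = 125, 840000 / 10^4 = 84, 840000 / 64 = 13125 and
5300000 / (2 * 4) = 662500, 5300000 / 10^5 = 53, 5300000 / 53 = 100000. *)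
Lemma pdc8 (R : realType) :
  pdc (k := 8) (@A8 R) (@B8 R) (@mu8 R) (1 / 64) (1 / 53) (Ga8 R) (GB8 R).
Proof.
split=> x.
  have -> : x ord0 0 = \sum_(i < 8) ofZ R (nth Z0 [:: Zpos 1] i) * x i 0.
    rewrite big_ord_recl big1 ?addr0 /= ?mul1r // => i _.
    by rewrite nth_nil mul0r.
  apply: (@Umx_psd R 7 _ _ mu8_num a8_num _ Ga8_rows 125 84 13125 (ofZ R 840 * ofZ R 1000)
    _ _ _ _ _ _ _ _ _ (@mu8E R) (@a8E R)); [|lra|lra|lra|by vm_compute..].
  by rewrite mulr_gt0 ?ofZ_gt0.
have -> : x ord0 0 - x (inord 1) 0
    = \sum_(i < 9) ofZ R (nth Z0 [:: Zpos 1; Zneg 1] i) * x i 0.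
  rewrite big_ord_recl big_ord_recl big1 ?addr0 /= => [|i _].
    rewrite mul1r mulN1r; congr (_ - x _ 0); apply: val_inj.
    by rewrite /= inordK.
  by rewrite nth_nil mul0r.
apply: (@Umx_psd R 8 _ _ nu8_num B8_num _ GB8_rows (Z.mul 6625 100) 53
  (Z.mul 1000 100) (ofZ R 53 * ofZ R 1000 * ofZ R 100)
  _ _ _ _ _ _ _ _ _ (@nu8E R) (@B8E R)); [| | | |by vm_compute..].
- by rewrite !mulr_gt0 ?ofZ_gt0.
- by rewrite ofZM; lra.
- lra.
- by rewrite ofZM; lra.
Qed.

Lemma chat8 (R : realType) : chat 8 (@mu8 R) (@Bh8 R) 0 = ofZ R 25043 / 4.
Proof.
have normE (z : Z) : `|ofZ R z| = ofZ R (Z.abs z).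
  case: z => [|p|p]; try by rewrite ger0_norm ?ofZ_ge0.
  by rewrite -[Zneg p]/(Z.opp (Zpos p)) ofZN normrN ger0_norm ?ofZ_ge0.
have mun i : (i < 8)%N -> `|mu8 R i| = 4^-1 * ofZ R (Z.abs (nth Z0 mu8_num i)).
  by move=> i8; rewrite mu8E // normrM normE ger0_norm ?invr_ge0.
have bhn i : (i < 8)%N -> `|bhat (@Bh8 R) i| = ofZ R (Z.abs (nth Z0 bhat8_num i)).
  move=> i8; rewrite -normE; congr `|_|; move: i8.
  by do 8 (case: i => [_|i]; first by rewrite /bhat unlock /Bh8 /=; lra).
rewrite /chat /ctilde !unlock /= !mun // !bhn //=.
lra.
Qed.

Lemma order_conditions8 (R : realType) : order_conditions 8 (@A8 R) (@B8 R) (@Bh8 R).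
Proof.
split; rewrite ?unlock /= /A8 /B8 /Bh8 /=; [lra| |lra..].
by do 8 (case=> [_|]; first by rewrite ?unlock /=; split; lra).
Qed.

Lemma feasible8 (R : realType) :
  feasible 8 (@A8 R) (@B8 R) (@mu8 R) (1 / 64) (1 / 53).
Proof.
have [_ _ _ B1 _] := order_conditions8 R.
have [Ha HB] := pdc8 R.
have [_ Gpos] := posdef_Ga8 R.
split; [by split; lra|split=> //; rewrite unlock /mu8 /=; lra| | |split].
- split; apply: size_genpoly; apply: lt0r_neq0.
  + rewrite a8E; last by [].
    apply: mulr_gt0; last exact: ofZ_gt0.
    by rewrite invr_gt0 ltr0n.
  + rewrite mu8E; last by [].
    apply: mulr_gt0; last exact: ofZ_gt0.
    by rewrite invr_gt0 ltr0n.
  + rewrite B8E; last by [].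
    by rewrite mul1r; apply: ofZ_gt0.
- move=> z; apply: (multiplier_root_lt1 _ _ Ha); first by lra.
  move=> x; have [->|/Gpos/ltW //] := eqVneq x 0.
  by rewrite mulmx0 mxE.
- exact: coprime_a8_mu8.
- exact: coprime_B8_nu8.
- exact: product_polynomial_ge Ha.
- apply: product_quotient_polynomial_ge HB.
  by rewrite !big_ord_recr big_ord0 /= !nu8E //=; lra.
Qed.

Theorem proposition4p3 (R : realType) :
  [/\ order_conditions 8 (@A8 R) (@B8 R) (@Bh8 R),
      feasible 8 (@A8 R) (@B8 R) (@mu8 R) (1 / 64) (1 / 53),
      @energy_dissipation R 8 (@A8 R) (@B8 R) (@Bh8 R) (@mu8 R) (1 / 64) (1 / 53)
        (Ga8 R) (GB8 R),
      [/\ posdefmx (Ga8 R), posdefmx (GB8 R) &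
          @pdc R 8 (@A8 R) (@B8 R) (@mu8 R) (1 / 64) (1 / 53)
            (Ga8 R) (GB8 R)] &
      chat 8 (@mu8 R) (@Bh8 R) 0 = ofZ R 25043 / 4].
Proof.
have [A0 _ _ _ Bh1] := order_conditions8 R.
split; [exact: order_conditions8|exact: feasible8| | |exact: chat8].
- by apply: pdc_energy_dissipation A0 Bh1 (pdc8 R); lra.
- by split; [exact: posdef_Ga8|exact: posdef_GB8|exact: pdc8].
Qed.
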